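(* Let $R$ be a commutative noetherian ring and let $\varphi\colon R\rightarrow A$ be a ring homomorphism making $A$ a finite $R$-algebra. The following two conditions are equivalent: (1) $A$ is Gorenstein projective as an $R$-module, and $\mathrm{Hom}_R(A,R)$ is projective both as a left $A$-module and as a right $A$-module. (2) $\varphi$ has ascent and descent of Gorenstein projective property.
   Context: Rings are associative with unit, not necessarily commutative. An $A$-module means a left $A$-module; right $A$-modules are identified with modules over the opposite ring $A^{\mathrm{op}}$. $A$ is a finite $R$-algebra via $\varphi$: the image of $\varphi$ lies in the center of $A$ and $A$ is finitely generated as an $R$-module (so $A$ is two-sided noetherian). $A$-modules and $A^{\mathrm{op}}$-modules are viewed as $R$-modules by restriction along $\varphi$. $\mathrm{Hom}_R(A,R)$ is an $A$-$A$-bimodule via $(a f)(x)=f(xa)$ and $(fa)(x)=f(ax)$. Gorenstein projective modules: for a noetherian ring $B$, an acyclic complex $\mathbf P=\cdots\to P_1\xrightarrow{\partial_1}P_0\xrightarrow{\partial_0}P_{-1}\to\cdots$ of projective $B$-modules is totally acyclic if $\mathrm{Hom}_B(\mathbf P,Q)$ is acyclic for every projective $B$-module $Q$. A $B$-module $M$ is Gorenstein projective if there is a totally acyclic complex $\mathbf P$ with $M\cong \mathrm{Im}(\partial_0)$. $\varphi$ has ascent and descent of Gorenstein projective property if: (i) each finitely generated $A$-module is Gorenstein projective over $A$ if and only if it is Gorenstein projective over $R$; and (ii) each finitely generated $A^{\mathrm{op}}$-module is Gorenstein projective over $A^{\mathrm{op}}$ if and only if it is Gorenstein projective over $R^{\mathrm{op}}=R$.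 *)

(* Defs.v *)
From HB Require Import structures.
From mathcomp Require Import all_boot all_order all_algebra.
From mathcomp Require Import boolp.

Set Implicit Arguments.
Unset Strict Implicit.
Unset Printing Implicit Defensive.

Import GRing.Theory.
Local Open Scope ring_scope.

(* Rings are [pzRingType]s: the zero ring is allowed. Left B-modules are
   [lmodType B] and right B-modules are [lmodType B^c]. *)

Definition finitely_generated (B : pzRingType) (M : lmodType B) : Prop :=
  exists (n : nat) (g : 'I_n -> M),
    forall x : M, exists c : 'I_n -> B, x = \sum_(i < n) c i *: g i.

Definition left_ideal (B : pzRingType) (I : B -> Prop) : Prop :=
  [/\ I 0, forall x y, I x -> I y -> I (x + y) & forall a x, I x -> I (a * x)].

Definition left_noetherian (B : pzRingType) : Prop :=
  forall I : B -> Prop, left_ideal I ->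
    exists (n : nat) (g : 'I_n -> B),
      forall x : B, I x <-> exists c : 'I_n -> B, x = \sum_(i < n) c i * g i.

Definition projective (B : pzRingType) (P : lmodType B) : Prop :=
  forall (M N : lmodType B) (p : {linear M -> N}) (f : {linear P -> N}),
    (forall y : N, exists x : M, p x = y) ->
    exists g : {linear P -> M}, forall x : P, p (g x) = f x.

Section HomGroup.
Variables (B : pzRingType) (U V : lmodType B).

(* An alias, so that its instances do not live on {linear U -> V} itself, where
   mathcomp.reals declares its own eqType and choiceType instances. *)
Definition Hom : Type := {linear U -> V}.

Definition hom_fun (f : Hom) : {linear U -> V} := f.
Coercion hom_fun : Hom >-> GRing.Linear.type.

Lemma hom_ext (f g : Hom) : (forall x, f x = g x) -> f = g.
Proof.
case: f g => [f [[Hf1] [Hf2]]] [g [[Hg1] [Hg2]]] /= /funext e.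
move: Hg1 Hg2; rewrite -{g}e => Hg1 Hg2.
by rewrite (Prop_irrelevance Hf1 Hg1) (Prop_irrelevance Hf2 Hg2).
Qed.

HB.instance Definition _ := gen_eqMixin Hom.
HB.instance Definition _ := gen_choiceMixin Hom.

Definition hom_zero : Hom := \0 : {linear U -> V}.
Definition hom_opp (f : Hom) : Hom := \- f : {linear U -> V}.
Definition hom_add (f g : Hom) : Hom := f \+ g : {linear U -> V}.

Lemma hom_addA : associative hom_add.
Proof. by move=> f g h; apply: hom_ext => x /=; rewrite addrA. Qed.
Lemma hom_addC : commutative hom_add.
Proof. by move=> f g; apply: hom_ext => x /=; rewrite addrC. Qed.
Lemma hom_add0 : left_id hom_zero hom_add.
Proof. by move=> f; apply: hom_ext => x /=; rewrite add0r. Qed.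
Lemma hom_addN : left_inverse hom_zero hom_opp hom_add.
Proof. by move=> f; apply: hom_ext => x /=; rewrite addNr. Qed.

HB.instance Definition _ :=
  GRing.isZmodule.Build Hom hom_addA hom_addC hom_add0 hom_addN.

End HomGroup.

Definition precomp (B : pzRingType) (U V Q : lmodType B) (d : {linear U -> V})
  (f : Hom V Q) : Hom U Q := (f : {linear V -> Q}) \o d : {linear U -> Q}.

Definition exact_at (U V W : zmodType) (f : U -> V) (g : V -> W) : Prop :=
  forall v : V, g v = 0 <-> exists u : U, f u = v.

Section GorensteinProjective.
Variable B : pzRingType.

(* In a complex, [d n] is the differential out of degree n. *)
Definition acyclic (P : int -> lmodType B)
    (d : forall n : int, {linear P n -> P (n - 1)}) : Prop :=
  forall n : int, exact_at (d n) (d (n - 1)).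

Definition Hom_acyclic (P : int -> lmodType B)
    (d : forall n : int, {linear P n -> P (n - 1)}) (Q : lmodType B) : Prop :=
  forall n : int,
    exact_at (@precomp B _ _ Q (d (n - 1))) (@precomp B _ _ Q (d n)).

Definition totally_acyclic (P : int -> lmodType B)
    (d : forall n : int, {linear P n -> P (n - 1)}) : Prop :=
  [/\ forall n, projective (P n),
      acyclic d
    & forall Q : lmodType B, projective Q -> Hom_acyclic d Q].

(* An isomorphism M ~ Im (d 0) is the same as an injective linear map from M
   to the codomain of d 0 whose image is Im (d 0). *)
Definition Gorenstein_projective (M : lmodType B) : Prop :=
  exists (P : int -> lmodType B)
         (d : forall n : int, {linear P n -> P (n - 1)}),
    totally_acyclic d /\
    exists2 i : {linear M -> P (0 - 1)}, injective i &
      forall y, (exists x, i x = y) <-> (exists z, d 0 z = y).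

End GorensteinProjective.

Definition restr (R A : pzRingType) of {rmorphism R -> A} :=
  fun M : lmodType A => M : Type.

Section Restriction.
Variables (R A : pzRingType) (phi : {rmorphism R -> A}) (M : lmodType A).
Local Notation resM := (restr phi M).

HB.instance Definition _ := GRing.Zmodule.copy resM M.

Definition restr_scale (r : R) (m : resM) : resM := phi r *: (m : M).

Lemma restr_scaleA r s m :
  restr_scale r (restr_scale s m) = restr_scale (r * s) m.
Proof. by rewrite /restr_scale rmorphM scalerA. Qed.
Lemma restr_scale1 : left_id 1 restr_scale.
Proof. by move=> m; rewrite /restr_scale rmorph1 scale1r. Qed.
Lemma restr_scaleDr : right_distributive restr_scale +%R.
Proof. by move=> r m n; rewrite /restr_scale scalerDr. Qed.
Lemma restr_scaleDl m : {morph restr_scale^~ m : r s / r + s}.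
Proof. by move=> r s; rewrite /restr_scale rmorphD scalerDl. Qed.

HB.instance Definition _ := GRing.Zmodule_isLmodule.Build R resM
  restr_scaleA restr_scale1 restr_scaleDr restr_scaleDl.

End Restriction.

Section OppositeMorphism.
Variables (R : comPzRingType) (A : pzRingType) (phi : {rmorphism R -> A}).

Definition op_mor (r : R) : A^c := phi r.

Lemma op_mor_zmod : zmod_morphism op_mor.
Proof. by move=> r s; exact: (rmorphB phi). Qed.
Lemma op_mor_monoid : monoid_morphism op_mor.
Proof.
by split=> [|r s]; [exact: (rmorph1 phi) | rewrite mulrC; exact: (rmorphM phi)].
Qed.

HB.instance Definition _ := GRing.isZmodMorphism.Build R A^c op_mor op_mor_zmod.
HB.instance Definition _ :=
  GRing.isMonoidMorphism.Build R A^c op_mor op_mor_monoid.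

Definition op_rmor : {rmorphism R -> A^c} := op_mor.

End OppositeMorphism.

Definition central (R A : pzRingType) (phi : R -> A) : Prop :=
  forall (r : R) (a : A), phi r * a = a * phi r.

Section DualBimodule.
Variables (R : comPzRingType) (A : pzRingType) (phi : {rmorphism R -> A}).

Definition dual : Type := Hom (restr phi A^o) R^o.
HB.instance Definition _ := GRing.Zmodule.on dual.

(* Hom_R(A, R) as a left A-module: (a f)(x) = f (x a). *)
Definition dual_left : Type := dual.
HB.instance Definition _ := GRing.Zmodule.on dual_left.

Definition rmul (a : A) (x : restr phi A^o) : restr phi A^o := (x : A) * a.

Lemma rmul_linear a : linear (rmul a).
Proof. by move=> r x y; rewrite /rmul mulrDl -mulrA. Qed.
HB.instance Definition _ a :=
  GRing.isLinear.Build R (restr phi A^o) (restr phi A^o) _ (rmul a)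
    (rmul_linear a).

Definition dual_left_scale (a : A) (f : dual_left) : dual_left :=
  precomp (rmul a) f.

Lemma dual_left_scaleA a b f :
  dual_left_scale a (dual_left_scale b f) = dual_left_scale (a * b) f.
Proof. by apply: hom_ext => x /=; rewrite /rmul mulrA. Qed.
Lemma dual_left_scale1 : left_id 1 dual_left_scale.
Proof. by move=> f; apply: hom_ext => x /=; rewrite /rmul mulr1. Qed.
Lemma dual_left_scaleDr : right_distributive dual_left_scale +%R.
Proof. by move=> a f g; apply: hom_ext. Qed.
Lemma dual_left_scaleDl f : {morph dual_left_scale^~ f : a b / a + b}.
Proof.
move=> a b; apply: hom_ext => x /=.
by rewrite /rmul mulrDr; exact: (raddfD (hom_fun f)).
Qed.

HB.instance Definition _ := GRing.Zmodule_isLmodule.Build A dual_left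
  dual_left_scaleA dual_left_scale1 dual_left_scaleDr dual_left_scaleDl.

(* Hom_R(A, R) as a right A-module: (f a)(x) = f (a x). This is R-linear in x
   because phi is central. *)
Hypothesis phiZ : central phi.

Definition dual_right of central phi : Type := dual.
Local Notation dualR := (dual_right phiZ).
HB.instance Definition _ := GRing.Zmodule.on dualR.

Definition lmul of central phi := fun (a : A^c) (x : restr phi A^o) =>
  (a : A) * (x : A) : restr phi A^o.

Lemma lmul_linear a : linear (lmul phiZ a).
Proof.
move=> r x y; rewrite /lmul mulrDr; congr (_ + _).
by rewrite [LHS]mulrA -phiZ -mulrA.
Qed.
HB.instance Definition _ a :=
  GRing.isLinear.Build R (restr phi A^o) (restr phi A^o) _ (lmul phiZ a)
    (lmul_linear a).

Definition dual_right_scale (a : A^c) (f : dualR) : dualR :=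
  precomp (lmul phiZ a) f.

Lemma dual_right_scaleA a b f :
  dual_right_scale a (dual_right_scale b f) = dual_right_scale (a * b) f.
Proof. by apply: hom_ext => x /=; rewrite /lmul mulrA. Qed.
Lemma dual_right_scale1 : left_id 1 dual_right_scale.
Proof. by move=> f; apply: hom_ext => x /=; rewrite /lmul mul1r. Qed.
Lemma dual_right_scaleDr : right_distributive dual_right_scale +%R.
Proof. by move=> a f g; apply: hom_ext. Qed.
Lemma dual_right_scaleDl f : {morph dual_right_scale^~ f : a b / a + b}.
Proof.
move=> a b; apply: hom_ext => x /=.
by rewrite /lmul mulrDl; exact: (raddfD (hom_fun f)).
Qed.

HB.instance Definition _ := GRing.Zmodule_isLmodule.Build A^c dualR
  dual_right_scaleA dual_right_scale1 dual_right_scaleDr dual_right_scaleDl.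

End DualBimodule.

Definition GP_ascent_descent (R : comPzRingType) (A : pzRingType)
    (phi : {rmorphism R -> A}) : Prop :=
  (forall M : lmodType A, finitely_generated M ->
     (Gorenstein_projective M <-> Gorenstein_projective (restr phi M))) /\
  (forall M : lmodType A^c, finitely_generated M ->
     (Gorenstein_projective M <->
      Gorenstein_projective (restr (op_rmor phi) M))).

(* Main.v *)
(* Write [GP] for the largest class of modules X that have no extensions by
   projectives and admit short exact sequences 0 -> K -> P -> X -> 0 and
   0 -> X -> P -> Y -> 0 with P projective and K, Y again in the class. It
   consists of the Gorenstein projective modules, and it is closed under
   extensions, retracts, direct powers and kernels of epimorphisms.

   Suppose first that (1) holds. The adjunction Hom_A(M, Hom_R(A, Q)) =
   Hom_R(M, Q) gives Ext_A(M, Hom_R(A, Q)) = Ext_R(M, Q). As Hom_R(A, R) is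
   A-projective and A is R-finite, Hom_R(A, Q) is A-projective for Q
   projective over R; this gives descent, since a module which has
   resolutions and coresolutions by Gorenstein projectives, and no higher
   extensions by projectives, is Gorenstein projective. As A is finite and
   Gorenstein projective over R, it is reflexive; hence a finite dual basis
   of Hom_R(A, R) as a right module produces left linear maps Hom_R(A, R) ->
   A whose images generate A. So every A-projective is a retract of some
   Hom_R(A, Q) and Ext_A(M, P) = 0 whenever M is Gorenstein projective over
   R; a coresolution of M over A starts with M -> Hom_R(A, Q) for an
   embedding M -> Q.

   Suppose now that (2) holds. The dual W of A is Gorenstein projective over R
   (this is where R is required to be noetherian), hence over A, and embeds in
   some A^n with a finite Gorenstein projective cokernel Y. Then Y is Gorenstein
   projective over R, so Ext_A(Y, W) = Ext_R(Y, R) = 0 and W is a summand of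
   A^n. *)
From HB Require Import structures.
From mathcomp Require Import all_boot all_order all_algebra.
From mathcomp Require Import boolp.
Require Import Defs.

Set Implicit Arguments.
Unset Strict Implicit.
Unset Printing Implicit Defensive.

Import GRing.Theory.
Local Open Scope ring_scope.

(** * Kernels and cokernels *)

Definition mklin (B : pzRingType) (U V : lmodType B) (f : U -> V)
  (fL : linear f) : {linear U -> V} :=
  HB.pack f (GRing.isLinear.Build B U V *:%R f fL).

Section Diagrams.
Variable B : pzRingType.
Implicit Types U V W X Y : lmodType B.

Definition surjective U V (f : U -> V) : Prop := forall y, exists x, f x = y.

Definition ses U V W (f : {linear U -> V}) (g : {linear V -> W}) : Prop :=
  [/\ injective f, surjective g & exact_at f g].

Lemma lin_inj U V (f : {linear U -> V}) :
  (forall x, f x = 0 -> x = 0) -> injective f.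
Proof.
move=> H x y e; apply/eqP; rewrite -subr_eq0; apply/eqP/H.
by rewrite linearB /= e subrr.
Qed.

(** Preimages under an injective map are unique, so a choice of them is linear. *)
Lemma lift_mono U V X (k : {linear U -> V}) (h : {linear X -> V}) :
  injective k -> (forall x, exists u, k u = h x) ->
  exists l : {linear X -> U}, forall x, k (l x) = h x.
Proof.
move=> ki H; have [l lE] := choice H.
have lL : linear l by move=> a x y; apply: ki; rewrite linearP !lE linearP.
by exists (mklin lL).
Qed.

(** The section [s] is only set-theoretic; as [h] kills the kernel of [c], the composite of [h] with
    [s] is linear all the same. *)
Lemma factor_epi U V X (c : {linear U -> V}) (h : {linear U -> X}) :
  surjective c -> (forall u, c u = 0 -> h u = 0) ->
  exists l : {linear V -> X}, forall u, l (c u) = h u.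
Proof.
move=> cs H; have [s sE] := choice cs.
have lE u : h (s (c u)) = h u.
  apply/eqP; rewrite -subr_eq0; apply/eqP.
  by rewrite -linearB; apply: H; rewrite linearB /= sE subrr.
have lL : linear (h \o s).
  by move=> a x y; rewrite -{1}(sE x) -{1}(sE y) -linearP /= lE linearP.
by exists (mklin lL).
Qed.

Section Kernel.
Variables (U V : lmodType B) (g : {linear U -> V}).

Definition kermod : Type := {x : U | g x = 0}.

Lemma kermod_inj (x y : kermod) : sval x = sval y -> x = y.
Proof. by move: x y => [x Hx] [y Hy] /= e; exact: eq_exist. Qed.

HB.instance Definition _ := gen_eqMixin kermod.
HB.instance Definition _ := gen_choiceMixin kermod.

Definition ker_zero : kermod := exist _ 0 (linear0 g).
Lemma ker_opp_subproof (x : kermod) : g (- sval x) = 0.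
Proof. by rewrite linearN /= (svalP x) oppr0. Qed.
Definition ker_opp (x : kermod) : kermod := exist _ _ (ker_opp_subproof x).
Lemma ker_add_subproof (x y : kermod) : g (sval x + sval y) = 0.
Proof. by rewrite linearD /= (svalP x) (svalP y) addr0. Qed.
Definition ker_add (x y : kermod) : kermod := exist _ _ (ker_add_subproof x y).
Lemma ker_scale_subproof a (x : kermod) : g (a *: sval x) = 0.
Proof. by rewrite linearZ /= (svalP x) scaler0. Qed.
Definition ker_scale a (x : kermod) : kermod :=
  exist _ _ (ker_scale_subproof a x).

Lemma ker_addA : associative ker_add.
Proof. by move=> x y z; apply: kermod_inj; exact: addrA. Qed.
Lemma ker_addC : commutative ker_add.
Proof. by move=> x y; apply: kermod_inj; exact: addrC. Qed.
Lemma ker_add0 : left_id ker_zero ker_add.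
Proof. by move=> x; apply: kermod_inj; exact: add0r. Qed.
Lemma ker_addN : left_inverse ker_zero ker_opp ker_add.
Proof. by move=> x; apply: kermod_inj; exact: addNr. Qed.
HB.instance Definition _ :=
  GRing.isZmodule.Build kermod ker_addA ker_addC ker_add0 ker_addN.

Lemma ker_scaleA a b x : ker_scale a (ker_scale b x) = ker_scale (a * b) x.
Proof. by apply: kermod_inj; exact: scalerA. Qed.
Lemma ker_scale1 : left_id 1 ker_scale.
Proof. by move=> x; apply: kermod_inj; exact: scale1r. Qed.
Lemma ker_scaleDr : right_distributive ker_scale +%R.
Proof. by move=> a x y; apply: kermod_inj; exact: scalerDr. Qed.
Lemma ker_scaleDl x : {morph ker_scale^~ x : a b / a + b}.
Proof. by move=> a b; apply: kermod_inj; exact: scalerDl. Qed.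
HB.instance Definition _ := GRing.Zmodule_isLmodule.Build B kermod
  ker_scaleA ker_scale1 ker_scaleDr ker_scaleDl.

Definition ker_incl (x : kermod) : U := sval x.
Lemma ker_incl_linear : linear ker_incl.
Proof. by []. Qed.

Lemma kernel_ex : exists (K : lmodType B) (k : {linear K -> U}),
  injective k /\ exact_at k g.
Proof.
exists kermod, (mklin ker_incl_linear); split; first exact: kermod_inj.
by move=> u; split=> [gu | [x <-]]; [exists (exist _ u gu) | exact: (svalP x)].
Qed.

End Kernel.

Section Cokernel.
Variables (U V : lmodType B) (f : {linear U -> V}).

(** Cosets are predicates, so functional and propositional extensionality make congruent
    representatives equal in the quotient. *)
Definition coset_pred (x y : V) : Prop := exists u, y - x = f u.
Definition cokermod : Type := {S : V -> Prop | exists x, S = coset_pred x}.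

HB.instance Definition _ := gen_eqMixin cokermod.
HB.instance Definition _ := gen_choiceMixin cokermod.

Definition cls (x : V) : cokermod :=
  exist _ (coset_pred x) (ex_intro _ x erefl).

Lemma clsP x y : cls x = cls y <-> exists u, f u = x - y.
Proof.
split=> [/(congr1 sval) /= e | [u e]].
  have : coset_pred x x by exists 0; rewrite subrr linear0.
  by rewrite e => -[u ->]; exists u.
apply: eq_exist; apply/funext => z; apply/propext; split=> -[v ev].
  by exists (v + u); rewrite linearD /= -ev e addrA subrK.
by exists (v - u); rewrite linearB /= -ev e opprB addrA subrK.
Qed.

Lemma cls_surj (S : cokermod) : exists x, cls x = S.
Proof. by case: S => S [x e]; exists x; apply: eq_exist. Qed.

Definition rep (S : cokermod) : V := sval (cid (cls_surj S)).
Lemma repK S : cls (rep S) = S.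
Proof. exact: svalP (cid (cls_surj S)). Qed.

Definition cok_opp S := cls (- rep S).
Definition cok_add S T := cls (rep S + rep T).
Definition cok_scale a S := cls (a *: rep S).

Lemma rep_cls x : exists u, f u = rep (cls x) - x.
Proof. by apply/clsP; rewrite repK. Qed.

Lemma cls_opp x : cok_opp (cls x) = cls (- x).
Proof.
have [u e] := rep_cls x; apply/clsP.
by exists (- u); rewrite linearN /= e opprB opprK addrC.
Qed.
Lemma cls_add x y : cok_add (cls x) (cls y) = cls (x + y).
Proof.
have [u e] := rep_cls x; have [v e'] := rep_cls y; apply/clsP.
by exists (u + v); rewrite linearD /= e e' opprD addrACA.
Qed.
Lemma cls_scale a x : cok_scale a (cls x) = cls (a *: x).
Proof.
have [u e] := rep_cls x; apply/clsP.
by exists (a *: u); rewrite linearZ /= e scalerBr.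
Qed.

Lemma cok_addA : associative cok_add.
Proof.
move=> S T W; rewrite -[S]repK -[T]repK -[W]repK.
by rewrite !cls_add addrA.
Qed.
Lemma cok_addC : commutative cok_add.
Proof. by move=> S T; rewrite /cok_add addrC. Qed.
Lemma cok_add0 : left_id (cls 0) cok_add.
Proof. by move=> S; rewrite -[S]repK cls_add add0r. Qed.
Lemma cok_addN : left_inverse (cls 0) cok_opp cok_add.
Proof. by move=> S; rewrite -[S]repK cls_opp cls_add addNr. Qed.
HB.instance Definition _ :=
  GRing.isZmodule.Build cokermod cok_addA cok_addC cok_add0 cok_addN.

Lemma cls_addE x y : cls x + cls y = cls (x + y).
Proof. exact: cls_add. Qed.

Lemma cok_scaleA a b S : cok_scale a (cok_scale b S) = cok_scale (a * b) S.
Proof. by rewrite -[S]repK !cls_scale scalerA. Qed.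
Lemma cok_scale1 : left_id 1 cok_scale.
Proof. by move=> S; rewrite -[S]repK cls_scale scale1r. Qed.
Lemma cok_scaleDr : right_distributive cok_scale +%R.
Proof.
move=> a S T; rewrite -[S]repK -[T]repK.
by rewrite cls_addE !cls_scale cls_addE scalerDr.
Qed.
Lemma cok_scaleDl S : {morph cok_scale^~ S : a b / a + b}.
Proof.
by move=> a b; rewrite -[S]repK !cls_scale cls_addE scalerDl.
Qed.
HB.instance Definition _ := GRing.Zmodule_isLmodule.Build B cokermod
  cok_scaleA cok_scale1 cok_scaleDr cok_scaleDl.

Lemma cls_linear : linear (cls : V -> cokermod).
Proof.
by move=> a x y; rewrite -cls_addE -cls_scale.
Qed.

Lemma cokernel_ex : exists (C : lmodType B) (c : {linear V -> C}),
  surjective c /\ exact_at f c.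
Proof.
exists cokermod, (mklin cls_linear); split; first exact: cls_surj.
by move=> v; rewrite /= (clsP v 0) subr0.
Qed.

End Cokernel.

Lemma ses_ker U V (g : {linear U -> V}) : surjective g ->
  exists (K : lmodType B) (k : {linear K -> U}), ses k g.
Proof. by move=> gs; have [K [k [ki ke]]] := kernel_ex g; exists K, k. Qed.

Lemma ses_coker U V (f : {linear U -> V}) : injective f ->
  exists (C : lmodType B) (c : {linear V -> C}), ses f c.
Proof. by move=> fi; have [C [c [cs ce]]] := cokernel_ex f; exists C, c. Qed.

End Diagrams.

(** * Extensions *)

Section Extensions.
Variable B : pzRingType.
Implicit Types U V W X Y K E G H P Q : lmodType B.

Lemma ses0 U V W (f : {linear U -> V}) (g : {linear V -> W}) u :
  ses f g -> g (f u) = 0.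
Proof. by case=> _ _ ex; apply/ex; exists u. Qed.

Lemma mono0 U V (f : {linear U -> V}) u : injective f -> f u = 0 -> u = 0.
Proof. by move=> fi e; apply: fi; rewrite e linear0. Qed.

Lemma pair_linear X U V (f : {linear X -> U}) (g : {linear X -> V}) :
  linear (fun x => (f x, g x)).
Proof. by move=> a x y; rewrite !linearP. Qed.
Definition pairl X U V (f : {linear X -> U}) (g : {linear X -> V}) :
  {linear X -> (U * V)%type} := mklin (pair_linear f g).

Lemma copair_linear X U V (f : {linear U -> X}) (g : {linear V -> X}) :
  linear (fun z : U * V => f z.1 + g z.2).
Proof. by move=> a x y; rewrite /= !linearP /= scalerDr addrACA. Qed.
Definition copairl X U V (f : {linear U -> X}) (g : {linear V -> X}) :
  {linear (U * V)%type -> X} := mklin (copair_linear f g).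

Definition complin U V W (g : {linear V -> W}) (f : {linear U -> V}) :
  {linear U -> W} := g \o f.
Definition idlin U : {linear U -> U} := idfun.
Definition zerolin U V : {linear U -> V} := \0.
Lemma fst_lin U V : linear (fun z : U * V => z.1).
Proof. by []. Qed.
Definition fstl U V := mklin (@fst_lin U V).
Lemma snd_lin U V : linear (fun z : U * V => z.2).
Proof. by []. Qed.
Definition sndl U V := mklin (@snd_lin U V).
Lemma sub_lin U V (f g : {linear U -> V}) : linear (fun x => f x - g x).
Proof.
by move=> a x y; rewrite (linearP f) (linearP g) opprD scalerBr addrACA.
Qed.
Definition subl U V (f g : {linear U -> V}) := mklin (sub_lin f g).
Definition inll U V : {linear U -> (U * V)%type} :=
  pairl (idlin U) (zerolin U V).
Definition inrl U V : {linear V -> (U * V)%type} :=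
  pairl (zerolin V U) (idlin V).
Lemma inlrE U V (z : (U * V)%type) : inll U V z.1 + inrl U V z.2 = z.
Proof. by case: z => x y; congr (_, _); rewrite /= ?addr0 ?add0r. Qed.

(** The pullback is the kernel of the difference map. The last two clauses identify [T] with the
    compatible pairs, so that [lift_mono] yields maps into [T]. *)
Lemma pullback_ex E G X (p : {linear E -> X}) (b : {linear G -> X}) :
  exists (T : lmodType B) (t1 : {linear T -> E}) (t2 : {linear T -> G}),
  [/\ forall x, p (t1 x) = b (t2 x), injective (pairl t1 t2)
    & forall e g, p e = b g -> exists x, pairl t1 t2 x = (e, g)].
Proof.
have [T [k [ki ke]]] := kernel_ex (subl (complin p (fstl E G))
                                        (complin b (sndl E G))).
exists T, (complin (fstl E G) k), (complin (sndl E G) k).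
split=> [x|x y [e1 e2]|e g eg].
- by apply/eqP; rewrite -subr_eq0; apply/eqP/(ke _).2; exists x.
- by apply: ki; rewrite [k x]surjective_pairing [k y]surjective_pairing e1 e2.
have [|x kx] := (ke (e, g)).1; first by rewrite /= eg subrr.
by exists x; rewrite /= kx.
Qed.

Lemma pullback_ses K E X G (i : {linear K -> E}) (p : {linear E -> X})
    (b : {linear G -> X}) : ses i p ->
  exists (T : lmodType B) (i' : {linear K -> T}) (t1 : {linear T -> E})
    (t2 : {linear T -> G}),
  [/\ ses i' t2, forall k, t1 (i' k) = i k, forall x, p (t1 x) = b (t2 x),
      injective (pairl t1 t2)
    & forall e g, p e = b g -> exists x, pairl t1 t2 x = (e, g)].
Proof.
move=> ip; have [ii ps ex] := ip.
have [T [t1 [t2 [com ti pt]]]] := pullback_ex p b.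
have [|i' i'E] := lift_mono (h := pairl i (zerolin K G)) ti.
  by move=> k; apply: pt; rewrite (ses0 k ip) linear0.
exists T, i', t1, t2; split=> //; last by move=> k; have [] := i'E k.
split=> [|g|x].
- apply: lin_inj => k e; apply: (mono0 ii).
  by have [<- _] := i'E k; rewrite e linear0.
- by have [e pe] := ps (b g); have [x [_ xg]] := pt _ _ pe; exists x.
split=> [x0|[k <-]]; last by have [] := i'E k.
have [|k kE] := (ex (t1 x)).1; first by rewrite com x0 linear0.
by exists k; apply: ti; rewrite i'E /= kE x0.
Qed.

(** [W] is the cokernel of k |-> (a k, - i k). The last two clauses present it by generators and
    relations, in place of the universal property. *)
Lemma pushout_ses K G H V (a : {linear K -> G}) (b : {linear G -> H})
    (i : {linear K -> V}) : ses a b ->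
  exists (W : lmodType B) (u : {linear G -> W}) (v : {linear V -> W})
    (q : {linear W -> H}),
  [/\ ses v q, forall k, u (a k) = v (i k), forall g, q (u g) = b g,
      forall w, exists g x, w = u g + v x
    & forall g x, u g + v x = 0 -> exists k, g = a k /\ x = - i k].
Proof.
move=> ab; have [ai bs ex] := ab.
have [W [c [cs ce]]] := cokernel_ex (pairl a (subl (zerolin K V) i)).
pose u := complin c (inll G V).
pose v := complin c (inrl G V).
have uv g x : c (g, x) = u g + v x.
  by rewrite -[in LHS](inlrE (g, x)) linearD.
have [|q qE] := factor_epi (h := complin b (fstl G V)) cs.
  by move=> z /ce [k <-]; exact: ses0 ab.
have quE g : q (u g) = b g by rewrite qE.
have qvE x : q (v x) = 0 by rewrite qE /= linear0.
have uvE g x : u g + v x = 0 -> exists k, g = a k /\ x = - i k.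
  by rewrite -uv => /ce [k [<- <-]]; exists k; rewrite sub0r.
have uvk k : u (a k) = v (i k).
  apply/eqP; rewrite -subr_eq0 -linearN -uv; apply/eqP/ce.
  by exists k; rewrite /= sub0r.
have gen w : exists g x, w = u g + v x.
  by have [[g x] <-] := cs w; exists g, x.
exists W, u, v, q; split=> //; split=> [|h|w].
- apply: lin_inj => x vx; have [|k [e ->]] := uvE 0 x.
    by rewrite linear0 add0r.
  by rewrite (mono0 ai (esym e)) linear0 oppr0.
- by have [g <-] := bs h; exists (u g).
split=> [|[x <-] //]; have [g [x ->]] := gen w.
rewrite linearD quE qvE addr0 => /ex [k <-].
by exists (i k + x); rewrite linearD uvk.
Qed.

Definition retract X G : Prop :=
  exists (s : {linear X -> G}) (r : {linear G -> X}), forall x, r (s x) = x.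

Lemma retract_trans X Y W : retract X Y -> retract Y W -> retract X W.
Proof.
move=> [s [r rs]] [s' [r' rs']]; exists (complin s' s), (complin r r').
by move=> x /=; rewrite rs' rs.
Qed.

Lemma proj_lift P U V (p : {linear U -> V}) (f : {linear P -> V}) :
  projective P -> surjective p ->
  exists g : {linear P -> U}, forall x, p (g x) = f x.
Proof. by move=> Pp; apply: Pp. Qed.

Lemma proj_retract P Q : retract P Q -> projective Q -> projective P.
Proof.
move=> [s [r rs]] Qp M N p f ps; have [g gE] := proj_lift (complin f r) Qp ps.
by exists (complin g s) => x /=; rewrite gE /= rs.
Qed.

Lemma proj_prod P Q : projective P -> projective Q -> projective (P * Q)%type.
Proof.
move=> Pp Qp M N p f ps.
have [g gE] := proj_lift (complin f (inll P Q)) Pp ps.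
have [h hE] := proj_lift (complin f (inrl P Q)) Qp ps.
exists (copairl g h) => z; rewrite -[in RHS](inlrE z) [RHS]linearD /=.
by rewrite linearD gE hE.
Qed.

Lemma section_retraction K E X (i : {linear K -> E}) (p : {linear E -> X})
    (s : {linear X -> E}) : ses i p -> (forall x, p (s x) = x) ->
  exists r : {linear E -> K},
    (forall k, r (i k) = k) /\ (forall e, i (r e) = e - s (p e)).
Proof.
move=> ip sE; have [ii ps ex] := ip.
have [|r rE] := lift_mono (h := subl (idlin E) (complin s p)) ii.
  by move=> x; apply/ex; rewrite /= linearB /= sE subrr.
exists r; split=> [k|e]; last by rewrite rE.
by apply: ii; rewrite rE /= (ses0 k ip) linear0 subr0.
Qed.

Lemma retraction_section K E X (i : {linear K -> E}) (p : {linear E -> X})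
    (r : {linear E -> K}) : ses i p -> (forall k, r (i k) = k) ->
  exists s : {linear X -> E}, forall x, p (s x) = x.
Proof.
move=> ip rE; have [ii ps ex] := ip.
have [|s sE] := factor_epi (h := subl (idlin E) (complin i r)) ps.
  by move=> x /ex [k <-] /=; rewrite rE subrr.
exists s => x; have [e <-] := ps x.
by rewrite sE /= linearB /= (ses0 _ ip) subr0.
Qed.

(* [orth X Q] says that Ext^1(X, Q) = 0, in the form that maps to [Q] extend
   along every monomorphism with cokernel [X]. *)
Definition orth X Q : Prop :=
  forall K E (i : {linear K -> E}) (p : {linear E -> X}), ses i p ->
  forall f : {linear K -> Q},
    exists g : {linear E -> Q}, forall k, g (i k) = f k.

Lemma orth_proj P Q : projective P -> orth P Q.
Proof.
move=> Pp K E i p ip f; have [_ ps _] := ip.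
have [s sE] := proj_lift (idlin P) Pp ps.
have [r [rE _]] := section_retraction ip sE.
by exists (complin f r) => k /=; rewrite rE.
Qed.

(** A piece of the long exact sequence. Pull the extension back to [G], extend over the pullback
    [T], subtract a map from [G] so that the copy of [K] in [T] is killed, and descend to [E]. *)
Lemma orth_ses K G X Q (a : {linear K -> G}) (b : {linear G -> X}) :
  ses a b -> orth G Q ->
  (forall f : {linear K -> Q},
    exists g : {linear G -> Q}, forall k, g (a k) = f k) ->
  orth X Q.
Proof.
move=> ab oG H K' E i p ip h; have [ai bs aex] := ab.
have [T [i' [t1 [t2 [it2 t1i com ti pt]]]]] := pullback_ses b ip.
have [w' w'E] := oG _ _ _ _ it2 h.
have t1s : surjective t1.
  move=> e; have [g bg] := bs (p e).
  by have [x [xe _]] := pt e g (esym bg); exists x.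
have [|j jE] := lift_mono (h := pairl (zerolin K E) a) ti.
  by move=> k; apply: pt; rewrite (ses0 k ab) linear0.
have [w wE] := H (complin w' j).
have [|l lE] := factor_epi (h := subl w' (complin w t2)) t1s.
  move=> x x0; have [|k kE] := (aex (t2 x)).1; first by rewrite -com x0 linear0.
  have -> : x = j k by apply: ti; rewrite jE /= x0 kE.
  by have [_ /= jk] := jE k; rewrite jk wE subrr.
exists l => k; rewrite -t1i lE /= w'E.
by rewrite (ses0 k it2) linear0 subr0.
Qed.

(** The preimage [T] of [K] in [E] cuts the problem in two: [oK] extends from [N] to [T], then [oH]
    from [T] to [E]. *)
Lemma orth_ext K G H Q (a : {linear K -> G}) (b : {linear G -> H}) :
  ses a b -> orth K Q -> orth H Q -> orth G Q.
Proof.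
move=> ab oK oH N E i p ip f; have [ai bs aex] := ab; have [ii ps iex] := ip.
have bps : surjective (complin b p).
  by move=> h; have [g <-] := bs h; have [e <-] := ps g; exists e.
have [T [t tbp]] := ses_ker bps; have [ti _ tex] := tbp.
have [|q qE] := lift_mono (h := complin p t) ai.
  by move=> x; apply/aex; exact: (ses0 x tbp).
have [|n nE] := lift_mono (h := i) ti.
  by move=> x; apply/tex; rewrite /= (ses0 x ip) linear0.
have nq : ses n q.
  split=> [|k|x].
  - by apply: lin_inj => x x0; apply: (mono0 ii); rewrite -nE x0 linear0.
  - have [e pe] := ps (a k).
    have [|x xe] := (tex e).1; first by rewrite /= pe (ses0 k ab).
    by exists x; apply: ai; rewrite qE /= xe.
  split=> [x0|[y <-]].
    have [|y yE] := (iex (t x)).1; first by rewrite -[p _]qE x0 linear0.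
    by exists y; apply: ti; rewrite nE.
  by apply: (mono0 ai); rewrite qE /= nE (ses0 y ip).
have [g gE] := oK _ _ _ _ nq f; have [h hE] := oH _ _ _ _ tbp g.
by exists h => y; rewrite -nE hE gE.
Qed.

(** Extend over the pullback along [r], and map [E] into that pullback by e |-> (e, s (p e)). *)
Lemma orth_retract X G Q : retract X G -> orth G Q -> orth X Q.
Proof.
move=> [s [r rs]] oG K E i p ip f.
have [T [i' [t1 [t2 [it2 t1i com ti pt]]]]] := pullback_ses r ip.
have [g gE] := oG _ _ _ _ it2 f.
have [|l lE] := lift_mono (h := pairl (idlin E) (complin s p)) ti.
  by move=> e; apply: pt; rewrite /= rs.
exists (complin g l) => k /=; rewrite -gE; congr (g _).
by apply: ti; rewrite lE /= t1i (ses0 k ip) (ses0 k it2) linear0.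
Qed.

Lemma orth_retract_r X Q Q' : retract Q Q' -> orth X Q' -> orth X Q.
Proof.
move=> [s [r rs]] o K E i p ip f; have [g gE] := o _ _ _ _ ip (complin s f).
by exists (complin r g) => k /=; rewrite gE /= rs.
Qed.

End Extensions.

(** * Classes closed under syzygies and cosyzygies *)

Section GoodClasses.
Variable B : pzRingType.
Implicit Types (C D : lmodType B -> Prop) (X Y K G H P Q : lmodType B).

Definition orthP X : Prop := forall Q, projective Q -> orth X Q.

Definition lstep C X : Prop :=
  exists (K P : lmodType B) (i : {linear K -> P}) (p : {linear P -> X}),
    [/\ ses i p, projective P & C K].

Definition rstep C X : Prop :=
  exists (P Y : lmodType B) (i : {linear X -> P}) (p : {linear P -> Y}),
    [/\ ses i p, projective P & C Y].

Definition good C : Prop :=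
  forall X, C X -> [/\ orthP X, lstep C X & rstep C X].

(** A greatest fixed point written as a union: membership is shown by exhibiting a good class that
    contains the module. *)
Definition GP X : Prop := exists C, good C /\ C X.

Lemma lstep_sub C D X : (forall Y, C Y -> D Y) -> lstep C X -> lstep D X.
Proof.
move=> CD [K [P [i [p [ip Pp CK]]]]]; exists K, P, i, p.
by split=> //; exact: CD.
Qed.

Lemma rstep_sub C D X : (forall Y, C Y -> D Y) -> rstep C X -> rstep D X.
Proof.
move=> CD [P [Y [i [p [ip Pp CY]]]]]; exists P, Y, i, p.
by split=> //; exact: CD.
Qed.

Lemma GP_good : good GP.
Proof.
move=> X [C [gC CX]]; have [oX lX rX] := gC _ CX.
have CG Y : C Y -> GP Y by exists C.
by split; [| exact: lstep_sub lX | exact: rstep_sub rX].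
Qed.

Lemma GP_orth X : GP X -> orthP X. Proof. by case/GP_good. Qed.
Lemma GP_left X : GP X -> lstep GP X. Proof. by case/GP_good. Qed.
Lemma GP_right X : GP X -> rstep GP X. Proof. by case/GP_good. Qed.

Lemma orthP_proj P : projective P -> orthP P.
Proof. by move=> Pp Q _; exact: orth_proj. Qed.

Lemma GP_proj P : projective P -> GP P.
Proof.
move=> Pp; exists (fun X => projective X); split=> // {Pp}P Pp.
split; first exact: orthP_proj.
  (* The zero module is realised as the kernel and, below, as the cokernel of the identity; it is
     projective as a retract of [P]. *)
  have [|K [k [ki ks ex]]] := ses_ker (g := idlin P).
    by move=> x; exists x.
  exists K, P, k, (idlin P); split=> //; apply: (proj_retract _ Pp).
  exists k, (zerolin P K) => x /=; apply: ki.
  by rewrite linear0; symmetry; apply: (ex _).2; exists x.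
have [|Y [c [ci cs ex]]] := ses_coker (f := idlin P); first by [].
exists P, Y, (idlin P), c; split=> //; apply: (proj_retract _ Pp).
exists (zerolin Y P), c => y /=; have [v <-] := cs y.
by rewrite linear0; symmetry; apply/ex; exists v.
Qed.

(** * Horseshoe lemmas and closure properties *)

Section Horseshoe.
Variables (C : lmodType B -> Prop).
Hypothesis C_ext : forall K G H (a : {linear K -> G}) (b : {linear G -> H}),
  ses a b -> C K -> C H -> C G.
Variables (K G H : lmodType B) (a : {linear K -> G}) (b : {linear G -> H}).
Hypothesis ab : ses a b.

(** A lift of [p2] through [b] joins with [p1] to a cover of [G] by P1 + P2, whose kernel is an
    extension of the two given kernels. *)
Lemma horseshoe_left : lstep C K -> lstep C H -> lstep C G.
Proof.
have [ai bs aex] := ab.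
move=> [K1 [P1 [i1 [p1 [ip1 P1p CK]]]]] [K2 [P2 [i2 [p2 [ip2 P2p CH]]]]].
have [i1i p1s ex1] := ip1; have [i2i p2s ex2] := ip2.
have [l lE] := proj_lift p2 P2p bs.
pose q := copairl (complin a p1) l.
have qs : surjective q.
  move=> g; have [y yE] := p2s (b g).
  have [|k kE] := (aex (g - l y)).1; first by rewrite linearB /= lE yE subrr.
  by have [x xE] := p1s k; exists (x, y); rewrite /= xE kE subrK.
have [L [k kq]] := ses_ker qs; have [ki _ kex] := kq.
have [|m mE] := lift_mono (h := complin (inll P1 P2) i1) ki.
  by move=> x; apply/kex; rewrite /= (ses0 x ip1) !linear0 addr0.
have [|n nE] := lift_mono (h := complin (sndl P1 P2) k) i2i.
  move=> x; apply/ex2; rewrite /= -lE.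
  have /(congr1 b) : q (k x) = 0 := ses0 x kq.
  by rewrite /= linearD linear0 (ses0 _ ab) add0r.
have mn : ses m n.
  split=> [|y|x].
  - apply: lin_inj => x x0; apply: (mono0 i1i).
    by have /(congr1 fst) /= <- := mE x; rewrite x0 linear0.
  - have [|c cE] := (aex (l (i2 y))).1; first by rewrite lE (ses0 y ip2).
    have [x xE] := p1s c.
    have [|z zE] := (kex (- x, i2 y)).1.
      by rewrite /= !linearN xE cE addNr.
    by exists z; apply: i2i; rewrite nE /= zE.
  split=> [x0|[y <-]]; last by apply: (mono0 i2i); rewrite nE /= mE.
  have k2 : (k x).2 = 0 by have := nE x; rewrite x0 linear0 /= => <-.
  have : q (k x) = 0 := ses0 x kq.
  rewrite /= k2 linear0 addr0 => /(mono0 ai) /ex1 [y yE].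
  by exists y; apply: ki; rewrite mE /= [RHS]surjective_pairing k2 yE.
exists L, (P1 * P2)%type, k, q; split=> //; first exact: proj_prod.
exact: C_ext mn CK CH.
Qed.

(** Orthogonality of [H] extends [i1] from [K] to [G]; with [i2] after [b] this embeds [G] into P1 +
    P2, and the cokernel is an extension of the two given cokernels. *)
Lemma horseshoe_right : orthP H -> rstep C K -> rstep C H -> rstep C G.
Proof.
have [ai bs aex] := ab.
move=> oH [P1 [K1 [i1 [p1 [ip1 P1p CK]]]]] [P2 [H2 [i2 [p2 [ip2 P2p CH]]]]].
have [i1i p1s ex1] := ip1; have [i2i p2s ex2] := ip2.
have [e eE] := oH _ P1p _ _ _ _ ab i1.
pose m := pairl e (complin i2 b).
have mi : injective m.
  apply: lin_inj => g [eg /(mono0 i2i)/aex [k kE]].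
  by rewrite -kE (mono0 i1i (u := k)) ?linear0 // -eE kE.
have [Y [c mc]] := ses_coker mi; have [_ cs cex] := mc.
have [|u uE] := factor_epi (h := complin c (inll P1 P2)) p1s.
  move=> x /ex1 [k <-]; apply/cex; exists (a k).
  by rewrite /= eE (ses0 k ab) linear0.
have [|v vE] := factor_epi (h := complin p2 (sndl P1 P2)) cs.
  by move=> z /cex [g <-] /=; exact: ses0 ip2.
have uv : ses u v.
  split=> [|h|y].
  - apply: lin_inj => y; have [x <-] := p1s y.
    rewrite uE /= => /cex [g [<- /(mono0 i2i)/aex [k <-]]].
    by rewrite eE (ses0 k ip1).
  - by have [x <-] := p2s h; exists (c (0, x)); rewrite vE.
  split=> [|[x <-]].
    have [[x1 x2] <-] := cs y; rewrite vE /= => /ex2 [h].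
    have [g <-] := bs h => <-; exists (p1 (x1 - e g)).
    rewrite uE /=; apply/eqP; rewrite eq_sym -subr_eq0 -linearB; apply/eqP/cex.
    by exists g; congr (_, _); rewrite /= ?subr0 // opprB addrC subrK.
  by have [z <-] := p1s x; rewrite uE vE /= linear0.
exists (P1 * P2)%type, Y, m, c; split=> //; first exact: proj_prod.
exact: C_ext uv CK CH.
Qed.

End Horseshoe.

Inductive extcl D : lmodType B -> Prop :=
| extcl_base X : D X -> extcl D X
| extcl_ext K G H (a : {linear K -> G}) (b : {linear G -> H}) :
    ses a b -> extcl D K -> extcl D H -> extcl D G.

(** Coinduction up to extensions: the steps of the generators need only land in the extension
    closure. The horseshoe lemmas carry the induction over extensions. *)
Lemma extcl_good D :
  (forall X, D X -> [/\ orthP X, lstep (extcl D) X & rstep (extcl D) X]) ->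
  good (extcl D).
Proof.
move=> HD X; elim=> {X}[X /HD //|K G H a b ab _ [oK lK rK] _ [oH lH rH]].
split; first by move=> Q Qp; apply: orth_ext ab (oK _ Qp) (oH _ Qp).
  exact: (horseshoe_left (@extcl_ext D) ab).
exact: (horseshoe_right (@extcl_ext D) ab).
Qed.

Lemma GP_ext K G H (a : {linear K -> G}) (b : {linear G -> H}) :
  ses a b -> GP K -> GP H -> GP G.
Proof.
move=> ab gK gH; exists (extcl GP); split; last first.
  by apply: extcl_ext ab _ _; apply: extcl_base.
apply: extcl_good => X /GP_good [oX lX rX].
split=> //; [apply: lstep_sub lX | apply: rstep_sub rX]; exact: extcl_base.
Qed.

(* If X is a retract of G, the cokernel Y' of X -> G -> P is a retract of
   Y' + X, which is an extension of P/G by G; dually for kernels. *)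
Lemma GP_retract X G : retract X G -> GP G -> GP X.
Proof.
move=> XG gG.
exists (fun Y => exists2 G, retract Y G & GP G); split; last by exists G.
move=> {X G XG gG}X [G XG gG]; have [s [r rs]] := XG.
have [oG [K [P [k [q [kq Pp gK]]]]] [P' [Y [i [c [ic Pp' gY]]]]]] := GP_good gG.
have [ki qs kex] := kq; have [ii cs cex] := ic.
split; first by move=> Q Qp; apply: orth_retract XG (oG _ Qp).
  have rqs : surjective (complin r q).
    by move=> x; have [y yE] := qs (s x); exists y; rewrite /= yE rs.
  have [L [l lrq]] := ses_ker rqs; have [li _ lex] := lrq.
  exists L, P, l, (complin r q); split=> //.
  exists (L * X)%type; first by exists (inll L X), (fstl L X).
  have [|m mE] := lift_mono (h := k) li.
    by move=> x; apply/lex; rewrite /= (ses0 x kq) linear0.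
  apply: (GP_ext (a := complin (inll L X) m) (b := copairl (complin q l) s))
    gK gG.
  split=> [|g|[y x]].
  - apply: lin_inj => x [x0]; apply: (mono0 ki).
    by rewrite -mE x0 linear0.
  - have [p pE] := qs (g - s (r g)).
    have [|y yE] := (lex p).1; first by rewrite /= pE linearB rs subrr.
    by exists (y, r g); rewrite /= yE pE subrK.
  split=> [/= e|[z <-]]; last first.
    by rewrite /= mE (ses0 z kq) linear0 addr0.
  have x0 : x = 0.
    have := congr1 r e; rewrite linearD rs linear0.
    by have /= -> := ses0 y lrq; rewrite add0r.
  move: e; rewrite x0 linear0 addr0 => /kex [z zE].
  by exists z; congr (_, _); apply: li; rewrite mE.
have isi : injective (complin i s).
  by apply: lin_inj => x /(mono0 ii) e; rewrite -(rs x) e linear0.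
have [Y' [c' isc]] := ses_coker isi; have [_ cs' cex'] := isc.
exists P', Y', (complin i s), c'; split=> //.
exists (Y' * X)%type; first by exists (inll Y' X), (fstl Y' X).
have [|u uE] := factor_epi (h := c) cs'.
  by move=> x /cex' [z <-]; exact: ses0 ic.
apply: (GP_ext (a := pairl (complin c' i) r) (b := complin u (fstl Y' X)))
  gG gY.
split=> [|y|[y x]].
- apply: lin_inj => g [/cex' [x /ii e] rg].
  by rewrite -e -(rs x) e rg linear0.
- by have [z <-] := cs y; exists (c' z, 0); rewrite /= uE.
split=> [/=|[g [<- _]]]; last by rewrite /= uE (ses0 g ic).
have [z <-] := cs' y; rewrite uE => /cex [g <-].
exists (g - s (r g) + s x); congr (_, _); last first.
  by rewrite linearD linearB !rs subrr add0r.
apply/eqP; rewrite -subr_eq0 -!linearB /=; apply/eqP/cex'.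
exists (x - r g); rewrite /= (linearB s); congr (i _).
by rewrite [RHS]addrAC [g - _ - g]addrAC subrr add0r addrC.
Qed.

(** Pull a projective cover P of [H] back along [b]. The pullback [T] is an extension of [G] by a
    module in [GP]; as the cover lifts through [b], [K] is a retract of [T]. *)
Lemma GP_kernel K G H (a : {linear K -> G}) (b : {linear G -> H}) :
  ses a b -> GP G -> GP H -> GP K.
Proof.
move=> ab gG gH; have [ai bs aex] := ab.
have [H1 [P [i [p [ip Pp gH1]]]]] := GP_left gH.
have [T [i' [t1 [t2 [it2 _ com ti pt]]]]] := pullback_ses b ip.
have [c cE] := proj_lift p Pp bs.
apply: (GP_retract (G := T)); last exact: GP_ext it2 gH1 gG.
have [|s sE] := lift_mono (h := pairl (zerolin K P) a) ti.
  by move=> k; apply: pt; rewrite (ses0 k ab) linear0.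
have [|r rE] := lift_mono (h := subl t2 (complin c t1)) ai.
  by move=> x; apply/aex; rewrite /= linearB cE com subrr.
exists s, r => k; apply: ai; rewrite rE /=; have [-> ->] := sE k.
by rewrite linear0 subr0.
Qed.

(** Push an embedding of [K] into a projective P out along [a]. The pushout [W] is an extension of
    [Y] by [G], so it is in [GP]; orthogonality of [H] splits P -> W -> H, so [H] is a retract of
    [W]. *)
Lemma GP_cokernel K G H (a : {linear K -> G}) (b : {linear G -> H}) :
  ses a b -> GP K -> GP G -> orthP H -> GP H.
Proof.
move=> ab gK gG oH; have [ai bs aex] := ab.
have [P [Y [i [p [ip Pp gY]]]]] := GP_right gK; have [ii ps iex] := ip.
have [W [u [v [q [vq uv qu gen van]]]]] := pushout_ses i ab.
have [r rE] := oH _ Pp _ _ _ _ vq (idlin P).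
have [s sE] := retraction_section vq rE.
apply: (GP_retract (G := W)); first by exists s, q.
have us : surjective (copairl u v).
  by move=> w; have [g [x ->]] := gen w; exists (g, x).
have [|c cE] := factor_epi (h := complin p (sndl G P)) us.
  by move=> [g x] /van [k [_ /= e]]; rewrite /= e linearN (ses0 k ip) oppr0.
have cuv g x : c (u g + v x) = p x by exact: cE (g, x).
apply: (GP_ext (a := u) (b := c)) gG gY; split=> [|y|w].
- apply: lin_inj => g ug; have [|k [-> /esym/eqP]] := van g 0.
    by rewrite ug linear0 addr0.
  by rewrite oppr_eq0 => /eqP/(mono0 ii) ->; rewrite linear0.
- by have [x <-] := ps y; exists (u 0 + v x).
split=> [|[g <-]]; last by rewrite -[u g]addr0 -(linear0 v) cuv linear0.
have [g [x ->]] := gen w; rewrite cuv => /iex [k <-].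
by exists (g + a k); rewrite linearD uv.
Qed.

End GoodClasses.

(** * Complete resolutions *)

Section CompleteResolutions.
Variable B : pzRingType.
Implicit Types (X Y K P Q : lmodType B).

(** Writing a degree as [m - 1] lets consecutive differentials compose without transport along
    equations between integers. *)
Lemma int_pred (n : int) : exists m : int, n = m - 1.
Proof. by exists (n + 1); rewrite addrK. Qed.

(** The kernels of the differentials of all totally acyclic complexes form a good class: adjacent
    kernels supply the two steps. *)
Lemma Gorenstein_projective_GP X : Gorenstein_projective X -> GP X.
Proof.
move=> [P [d [dt [i ii ie]]]].
exists (fun Y => exists (P : int -> lmodType B)
    (d : forall n : int, {linear P n -> P (n - 1)}), totally_acyclic d /\
    exists n (k : {linear Y -> P n}), injective k /\ exact_at k (d n)).
split; last first.
  exists P, d; split=> //; exists (0 - 1), i; split=> // y.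
  by have [_ ac _] := dt; rewrite (ac 0 y) ie.
move=> {X P d dt i ii ie}X [P [d [dt [n [k [ki kex]]]]]].
have [Pp ac hac] := dt.
have CP m (Y : lmodType B) (l : {linear Y -> P m}) :
  injective l -> exact_at l (d m) -> exists (P : int -> lmodType B)
    (d : forall n : int, {linear P n -> P (n - 1)}), totally_acyclic d /\
    exists n (k : {linear Y -> P n}), injective k /\ exact_at k (d n).
  by move=> li lex; exists P, d; split=> //; exists m, l.
have [m en] := int_pred n; subst n.
have [|q qE] := lift_mono (h := d m) ki.
  by move=> x; apply/kex/ac; exists x.
have qs : surjective q.
  move=> x; have /ac [z zE] : d (m - 1) (k x) = 0 by apply/kex; exists x.
  by exists z; apply: ki; rewrite qE.
have [K [j jq]] := ses_ker qs; have [ji _ jex] := jq.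
have jexd : exact_at j (d m).
  move=> v; split=> [v0|/jex v0]; last by rewrite -qE v0 linear0.
  by apply/jex/ki; rewrite qE v0 linear0.
split.
- move=> Q Qp; apply: (orth_ses jq); first exact: orth_proj.
  (* In the new indexing [P (t - 1)] covers [K] by [e]. The composite of [f] with [e] vanishes on
     boundaries, so acyclicity of the Hom complex writes it as [g] after [d (t - 1)], and [g]
     extends [f]. *)
  have [l em] := int_pred m; subst m; have [t el] := int_pred l; subst l.
  move=> f; have [|e eE] := lift_mono (h := d (t - 1)) ji.
    by move=> x; apply/jexd/ac; exists x.
  have [|g gE] := (hac Q Qp t (f \o e : {linear _ -> _})).1.
    apply: hom_ext => z /=; rewrite -[RHS](linear0 f); congr (f _); apply: ji.
    by rewrite eE linear0; apply/ac; exists z.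
  exists (hom_fun g) => x; have /ac [z zE] : d (t - 1 - 1) (j x) = 0.
    by apply/jexd; exists x.
  have -> : x = e z by apply: ji; rewrite eE.
  by rewrite eE; exact: (congr1 (fun h : Hom (P (t - 1)) Q => h z) gE).
- by exists K, (P m), j, q; split=> //; exact: CP jexd.
have [Y [c kc]] := ses_coker ki; have [_ cs cex] := kc.
have [|l lE] := factor_epi (h := d (m - 1)) cs.
  by move=> x /cex/kex.
exists (P (m - 1)), Y, k, c; split=> //; apply: (CP _ _ l).
  apply: lin_inj => y; have [x <-] := cs y.
  by rewrite lE => /kex [z <-]; exact: ses0 kc.
move=> v; rewrite ac; split=> -[x <-]; first by exists (c x).
by have [z <-] := cs x; exists z.
Qed.

(** Choice turns the steps into functions [pv] and [nx] on the modules in [GP]; iterating them from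
    [X] gives short exact sequences that splice into a complex. *)
Lemma GP_Gorenstein_projective X : GP X -> Gorenstein_projective X.
Proof.
move=> gX; pose T := {Y : lmodType B | GP Y}.
pose R (U V : lmodType B) := exists (P : lmodType B)
    (f : {linear U -> P} * {linear P -> V}),
  projective P /\ ses f.1 f.2.
have [nx nxE] : {nx : T -> T & forall Y : T, R (sval Y) (sval (nx Y))}.
  apply: (choice (P := fun Y Y' : T => R (sval Y) (sval Y'))) => -[Y gY].
  have [P [Y' [i [p [ip Pp gY']]]]] := GP_right gY.
  by exists (exist _ _ gY'), P, (i, p).
have [pv pvE] : {pv : T -> T & forall Y : T, R (sval (pv Y)) (sval Y)}.
  apply: (choice (P := fun Y Y' : T => R (sval Y') (sval Y))) => -[Y gY].
  have [Y' [P [i [p [ip Pp gY']]]]] := GP_left gY.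
  by exists (exist _ _ gY'), P, (i, p).
pose X0 : T := exist _ X gX.
(* [Z n] will be the kernel of [d n]. The offset puts [X] at degree -1, where the image of [d 0]
   lies. *)
pose Z (n : int) : T := match n with
  | Posz n => iter n.+1 pv X0 | Negz n => iter n nx X0 end.
have ZR n : R (sval (Z n)) (sval (Z (n - 1))).
  case: n => [[|n]|n]; first exact: pvE.
    have -> : Posz n.+1 - 1 = Posz n by rewrite -[n.+1]addn1 PoszD addrK.
    exact: pvE.
  have -> : Negz n - 1 = Negz n.+1; last exact: nxE.
  by rewrite !NegzE -opprD -PoszD addn1.
pose P n : lmodType B := sval (cid (ZR n)).
pose f n := sval (cid (svalP (cid (ZR n)))).
have fE n : projective (P n) /\ ses (f n).1 (f n).2.
  exact: svalP (cid (svalP (cid (ZR n)))).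
pose d n : {linear P n -> P (n - 1)} := complin (f (n - 1)).1 (f n).2.
have ker_d n v : d n v = 0 <-> (f n).2 v = 0.
  have [_ [fi _ _]] := fE (n - 1).
  by split=> [/(mono0 fi) | /= ->] //; rewrite linear0.
exists P, d; split; last first.
  exists (f (0 - 1)).1; first by have [_ []] := fE (0 - 1).
  move=> y; have [_ [_ fs _]] := fE 0; split=> -[z <-]; last first.
    by exists ((f 0).2 z).
  by have [x <-] := fs z; exists x.
split=> [n|n v|Q Qp n]; first by have [] := fE n.
  have [_ [_ fs _]] := fE n; have [_ [_ _ ex]] := fE (n - 1).
  rewrite ker_d ex; split=> -[x <-]; last by exists ((f n).2 x).
  by have [z <-] := fs x; exists z.
move=> h; split=> [h0|[g <-]]; last first.
  apply: hom_ext => x /=; have [_ se] := fE (n - 1).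
  by rewrite (ses0 _ se) !linear0.
have [_ [_ fs _]] := fE n; have [_ [_ fs1 ex1]] := fE (n - 1).
(* As [h] kills boundaries, it factors through the cycles one degree lower; the map extends from
   there because the next cycle module is orthogonal to [Q]. *)
have [|l lE] := factor_epi (h := h) fs1.
  move=> v /ex1 [u <-]; have [z <-] := fs u.
  exact: (congr1 (fun k : Hom (P n) Q => k z) h0).
have [_ se] := fE (n - 1 - 1).
have [g gE] := GP_orth (svalP (Z (n - 1 - 1 - 1))) Qp se l.
by exists (g : Hom _ Q); apply: hom_ext => x /=; rewrite gE lE.
Qed.

Lemma GPP X : Gorenstein_projective X <-> GP X.
Proof.
split; first exact: Gorenstein_projective_GP.
exact: GP_Gorenstein_projective.
Qed.

End CompleteResolutions.

(** * Direct powers *)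

Lemma big_undup_supp (I : eqType) (V : nmodType) (h : I -> V) (s1 s2 : seq I) :
  (forall i, i \notin s1 -> h i = 0) -> (forall i, i \notin s2 -> h i = 0) ->
  \sum_(i <- undup s1) h i = \sum_(i <- undup s2) h i.
Proof.
have filt s : \sum_(i <- undup s) h i = \sum_(i <- undup s | h i != 0) h i.
  by rewrite [RHS]big_mkcond; apply: eq_bigr => i _; case: eqP.
move=> H1 H2; rewrite (filt s1) (filt s2) -!(big_filter (undup _)).
apply: perm_big; apply: uniq_perm; rewrite ?filter_uniq ?undup_uniq // => i.
rewrite !mem_filter !mem_undup; case: eqP => //= hi.
have [i1|/H1 //] := boolP (i \in s1); have [i2|/H2 //] := boolP (i \in s2).
by [].
Qed.

Definition fsupp (I : eqType) (V : nmodType) (h : I -> V) : Prop :=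
  exists s : seq I, forall i, i \notin s -> h i = 0.

Section Powers.
Variables (B : pzRingType) (I : choiceType).

Section Carrier.
Variable M : lmodType B.

(** The direct sum of copies of [M] indexed by [I]. A list bounding the support merely exists, so
    elements are equal when their coordinates are. *)
Definition pow : Type :=
  {f : I -> M | fsupp f}.

HB.instance Definition _ := gen_eqMixin pow.
HB.instance Definition _ := gen_choiceMixin pow.

Definition coef (x : pow) : I -> M := sval x.
Arguments coef : simpl never.

Lemma pow_ext (x y : pow) : (forall i, coef x i = coef y i) -> x = y.
Proof. by move: x y => [x Hx] [y Hy] /= /funext e; exact: eq_exist. Qed.

Lemma pow_supp (x : pow) : fsupp (coef x).
Proof. exact: svalP x. Qed.

Lemma pow_zero_supp : fsupp (fun _ : I => 0 : M).
Proof. by exists [::]. Qed.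
Definition pow_zero : pow := exist _ _ pow_zero_supp.

Lemma pow_opp_supp x : fsupp (fun i => - coef x i).
Proof.
by have [s H] := pow_supp x; exists s => i /H ->; rewrite oppr0.
Qed.
Definition pow_opp x : pow := exist _ _ (pow_opp_supp x).

Lemma pow_add_supp x y : fsupp (fun i => coef x i + coef y i).
Proof.
have [s H] := pow_supp x; have [t H'] := pow_supp y; exists (s ++ t) => i.
by rewrite mem_cat negb_or => /andP[/H -> /H' ->]; rewrite addr0.
Qed.
Definition pow_add x y : pow := exist _ _ (pow_add_supp x y).

Lemma pow_scale_supp a x : fsupp (fun i => a *: coef x i).
Proof.
by have [s H] := pow_supp x; exists s => i /H ->; rewrite scaler0.
Qed.
Definition pow_scale a x : pow := exist _ _ (pow_scale_supp a x).

Lemma pow_addA : associative pow_add.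
Proof. by move=> x y z; apply: pow_ext => i; exact: addrA. Qed.
Lemma pow_addC : commutative pow_add.
Proof. by move=> x y; apply: pow_ext => i; exact: addrC. Qed.
Lemma pow_add0 : left_id pow_zero pow_add.
Proof. by move=> x; apply: pow_ext => i; exact: add0r. Qed.
Lemma pow_addN : left_inverse pow_zero pow_opp pow_add.
Proof. by move=> x; apply: pow_ext => i; exact: addNr. Qed.
HB.instance Definition _ :=
  GRing.isZmodule.Build pow pow_addA pow_addC pow_add0 pow_addN.

Lemma pow_scaleA a b x : pow_scale a (pow_scale b x) = pow_scale (a * b) x.
Proof. by apply: pow_ext => i; exact: scalerA. Qed.
Lemma pow_scale1 : left_id 1 pow_scale.
Proof. by move=> x; apply: pow_ext => i; exact: scale1r. Qed.
Lemma pow_scaleDr : right_distributive pow_scale +%R.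
Proof. by move=> a x y; apply: pow_ext => i; exact: scalerDr. Qed.
Lemma pow_scaleDl x : {morph pow_scale^~ x : a b / a + b}.
Proof. by move=> a b; apply: pow_ext => i; exact: scalerDl. Qed.
HB.instance Definition _ := GRing.Zmodule_isLmodule.Build B pow
  pow_scaleA pow_scale1 pow_scaleDr pow_scaleDl.

Lemma coef_linear i : linear (coef^~ i).
Proof. by []. Qed.
Definition coefl i : {linear pow -> M} := mklin (coef_linear i).

Lemma coefD x y i : coef (x + y) i = coef x i + coef y i. Proof. by []. Qed.
Lemma coefZ a x i : coef (a *: x) i = a *: coef x i. Proof. by []. Qed.
Lemma coef_sum J (r : seq J) (F : J -> pow) i :
  coef (\sum_(j <- r) F j) i = \sum_(j <- r) coef (F j) i.
Proof. exact: (raddf_sum (coefl i)). Qed.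

Definition single_fun (i : I) (m : M) (j : I) : M := if j == i then m else 0.
Lemma single_supp i m : fsupp (single_fun i m).
Proof.
by exists [:: i] => j; rewrite inE /single_fun => /negbTE ->.
Qed.
Definition single i m : pow := exist _ _ (single_supp i m).
Lemma coef_single i m j : coef (single i m) j = if j == i then m else 0.
Proof. by []. Qed.

Lemma single_linear i : linear (single i).
Proof.
move=> a x y; apply: pow_ext => j; rewrite coefD coefZ !coef_single.
by case: eqP => // _; rewrite scaler0 addr0.
Qed.
Definition singlel i : {linear M -> pow} := mklin (single_linear i).

Lemma pow_sum_single x s : (forall i, i \notin s -> coef x i = 0) ->
  x = \sum_(i <- undup s) single i (coef x i).
Proof.
move=> H; apply: pow_ext => j; rewrite coef_sum.
have [js|jns] := boolP (j \in s).
  rewrite (bigD1_seq j) ?mem_undup ?undup_uniq //= coef_single eqxx.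
  by rewrite big1 ?addr0 // => i; rewrite coef_single eq_sym => /negbTE ->.
rewrite H // big1_seq // => i /=; rewrite mem_undup coef_single => si.
by case: eqP si jns => // -> ->.
Qed.

End Carrier.
Arguments coef : simpl never.

Lemma pow_lin_ext (M N : lmodType B) (f g : {linear pow M -> N}) :
  (forall i m, f (single i m) = g (single i m)) -> forall x, f x = g x.
Proof.
move=> H x; have [s /pow_sum_single ->] := pow_supp x.
by rewrite !linear_sum; apply: eq_bigr.
Qed.

Section Universal.
Variables (M N : lmodType B) (F : I -> {linear M -> N}).

(** The sum runs over some chosen list bounding the support; by [pow_univ_funE] any other such list
    gives the same value. *)
Definition pow_univ_fun (x : pow M) : N :=
  \sum_(i <- undup (sval (cid (pow_supp x)))) F i (coef x i).

Lemma pow_univ_funE x s : (forall i, i \notin s -> coef x i = 0) ->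
  pow_univ_fun x = \sum_(i <- undup s) F i (coef x i).
Proof.
move=> H; apply: big_undup_supp => i; last by move/H ->; rewrite linear0.
by move/(svalP (cid (pow_supp x))) => ->; rewrite linear0.
Qed.

Lemma pow_univ_linear : linear pow_univ_fun.
Proof.
move=> a x y; have [s Hs] := pow_supp x; have [t Ht] := pow_supp y.
have H i : i \notin s ++ t -> coef x i = 0 /\ coef y i = 0.
  by rewrite mem_cat negb_or => /andP[/Hs -> /Ht ->].
rewrite !(@pow_univ_funE _ (s ++ t)); try by move=> i /H [].
  by rewrite scaler_sumr -big_split; apply: eq_bigr => i _; rewrite linearP.
by move=> i /H [x0 y0]; rewrite coefD coefZ x0 y0 scaler0 addr0.
Qed.
Definition pow_univ : {linear pow M -> N} := mklin pow_univ_linear.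

Lemma pow_univ_single i m : pow_univ (single i m) = F i m.
Proof.
rewrite [LHS](@pow_univ_funE _ [:: i]); last first.
  by move=> j; rewrite inE coef_single => /negbTE ->.
by rewrite big_seq1 coef_single eqxx.
Qed.

End Universal.
Arguments pow_univ : simpl never.

Section ToPower.
Variables (X M : lmodType B) (F : I -> {linear X -> M}).
Hypothesis F_supp : forall x, fsupp (F^~ x).
Definition to_pow_fun x : pow M := exist _ _ (F_supp x).
Lemma to_pow_linear : linear to_pow_fun.
Proof. by move=> a x y; apply: pow_ext => i; exact: linearP. Qed.
Definition to_pow : {linear X -> pow M} := mklin to_pow_linear.
End ToPower.

Section Map.
Variables (M N : lmodType B) (f : {linear M -> N}).

Lemma pow_map_supp (x : pow M) : fsupp (fun i => complin f (coefl M i) x).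
Proof.
by have [s H] := pow_supp x; exists s => i /H e; rewrite /= e linear0.
Qed.
Definition pow_map : {linear pow M -> pow N} := to_pow pow_map_supp.
Lemma coef_pow_map x i : coef (pow_map x) i = f (coef x i).
Proof. by []. Qed.

End Map.
Arguments pow_map : simpl never.

Lemma pow_map_single (M N : lmodType B) (f : {linear M -> N}) i m :
  pow_map f (single i m) = single i (f m).
Proof.
apply: pow_ext => j; rewrite coef_pow_map !coef_single.
by case: eqP => // _; rewrite linear0.
Qed.

Lemma ses_pow (K G H : lmodType B) (a : {linear K -> G}) (b : {linear G -> H}) :
  ses a b -> ses (pow_map a) (pow_map b).
Proof.
move=> [ai bs ex].
have lift (U V : lmodType B) (p : {linear U -> V}) (y : pow V) :
    (forall i, exists u, p u = coef y i) -> exists x, pow_map p x = y.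
  move=> /choice [s sE]; have [t Ht] := pow_supp y.
  (* A chosen preimage of 0 need not be 0, so the choice is cut off outside a list bounding the
     support. *)
  have supp : fsupp (fun i => if i \in t then s i else 0).
    by exists t => i /negbTE ->.
  exists (exist _ _ supp); apply: pow_ext => i.
  suff e : p (if i \in t then s i else 0) = coef y i by exact: e.
  by case: ifP => [_|/negbT/Ht ->]; [exact: sE | exact: linear0].
split=> [|y|x].
- apply: lin_inj => x x0; apply: pow_ext => i; apply: (mono0 ai).
  exact: (congr1 (coefl G i) x0).
- by apply: lift => i; exact: bs.
split=> [x0|[z <-]].
  by apply: lift => i; apply/ex; exact: (congr1 (coefl H i) x0).
by apply: pow_ext => i; rewrite !coef_pow_map; apply/ex; exists (coef z i).
Qed.

Lemma retract_pow (X Y : lmodType B) : retract X Y -> retract (pow X) (pow Y).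
Proof.
move=> [s [r rs]]; exists (pow_map s), (pow_map r) => x.
by apply: pow_ext => i; rewrite !coef_pow_map.
Qed.

Lemma proj_pow (P : lmodType B) : projective P -> projective (pow P).
Proof.
move=> Pp M N p f ps.
have /choice [g gE] i : exists g : {linear P -> M},
    forall x, p (g x) = f (single i x).
  exact: (proj_lift (complin f (singlel P i)) Pp ps).
exists (pow_univ g) => x.
apply: (pow_lin_ext (f := complin p (pow_univ g))) => i m.
by rewrite -gE -(pow_univ_single g).
Qed.

(** All powers of modules in [GP] form a good class: steps are taken coordinatewise, and a map out
    of a power is a family of maps, each extended separately. *)
Lemma GP_pow (X : lmodType B) : GP X -> GP (pow X).
Proof.
move=> gX; exists (fun Y => exists2 Z, Y = pow Z :> lmodType B & GP Z).
split; last by exists X.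
move=> {X gX} _ [X -> /GP_good [oX [K [P [k [q [kq Pp gK]]]]]]].
move=> [P' [Y [i [c [ic Pp' gY]]]]]; split.
- move=> Q Qp; apply: (orth_ses (ses_pow kq)).
    exact/orth_proj/proj_pow.
  move=> f; have /choice [g gE] j : exists g : {linear P -> Q},
      forall x, g (k x) = f (single j x).
    exact: (oX _ Qp _ _ _ _ kq (complin f (singlel K j))).
  exists (pow_univ g).
  apply: (pow_lin_ext (f := complin (pow_univ g) (pow_map k))) => j m.
  by rewrite -gE -(pow_univ_single g) -pow_map_single.
- exists (pow K), (pow P), (pow_map k), (pow_map q).
  by split; [exact: ses_pow | exact: proj_pow | exists K].
exists (pow P'), (pow Y), (pow_map i), (pow_map c).
by split; [exact: ses_pow | exact: proj_pow | exists Y].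
Qed.

End Powers.
Arguments pow {B} I M.
Arguments single {B I M}.
Arguments coef {B I M} : simpl never.
Arguments pow_univ {B I M N} : simpl never.
Arguments pow_map {B} I {M N} : simpl never.

(** * Free and finitely generated modules *)

Section FreeModules.
Variable B : pzRingType.
Implicit Types (I : choiceType) (M N X Y P Q : lmodType B).

Lemma scaleby_linear M (m : M) : linear (fun b : B^o => (b : B) *: m).
Proof. by move=> a x y; rewrite scalerDl scalerA. Qed.
Definition scaleby M (m : M) : {linear B^o -> M} := mklin (scaleby_linear m).

Lemma proj_regular : projective B^o.
Proof.
move=> M N p f ps; have [x px] := ps (f 1); exists (scaleby x) => b /=.
by rewrite linearZ /= px -linearZ /=; congr (f _); exact: mulr1.
Qed.

Lemma proj_free I : projective (pow I B^o).
Proof. exact/proj_pow/proj_regular. Qed.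

Lemma free_cover M :
  exists I (p : {linear pow I B^o -> M}), surjective p.
Proof.
exists M, (pow_univ (fun m : M => scaleby m)) => m.
exists (single (m : M) (1 : B^o) : pow M B^o).
by rewrite pow_univ_single /= scale1r.
Qed.

Lemma proj_retract_free P : projective P -> exists I, retract P (pow I B^o).
Proof.
move=> Pp; have [I [p ps]] := free_cover P.
by have [s sE] := proj_lift (idlin P) Pp ps; exists I, s, p.
Qed.

Lemma pow_ord_sum n M (x : pow 'I_n M) : x = \sum_(i < n) single i (coef x i).
Proof.
rewrite {1}(pow_sum_single (x := x) (s := enum 'I_n)).
  by rewrite undup_id ?enum_uniq // big_enum.
by move=> i; rewrite mem_enum.
Qed.

Lemma pow_univ_ord n M N (F : 'I_n -> {linear M -> N}) (x : pow 'I_n M) :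
  pow_univ F x = \sum_(i < n) F i (coef x i).
Proof.
rewrite {1}(pow_ord_sum x) linear_sum; apply: eq_bigr => i _.
exact: pow_univ_single.
Qed.

Lemma pow_ord_supp n M (h : 'I_n -> M) : fsupp h.
Proof. by exists (enum 'I_n) => i; rewrite mem_enum. Qed.
Definition pow_ord n M (h : 'I_n -> M) : pow 'I_n M :=
  exist _ _ (pow_ord_supp h).

(** Projection to the coordinates in [s] and inclusion back; this replaces a large free module by a
    finite one. *)
Lemma finite_part I M (s : seq I) :
  exists n (u : {linear pow I M -> pow 'I_n M})
    (v : {linear pow 'I_n M -> pow I M}),
  forall x, (forall i, i \notin s -> coef x i = 0) -> v (u x) = x.
Proof.
pose t := in_tuple (undup s).
have supp (x : pow I M) : fsupp (fun k => coefl M (tnth t k) x).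
  exact: pow_ord_supp.
exists (size (undup s)), (to_pow supp).
exists (pow_univ (fun k => singlel M (tnth t k))) => x xs.
by rewrite pow_univ_ord [RHS](pow_sum_single xs) [RHS]big_tnth.
Qed.

Lemma fg_surj M N (p : {linear M -> N}) :
  surjective p -> finitely_generated M -> finitely_generated N.
Proof.
move=> ps [n [g gE]]; exists n, (p \o g) => y; have [x <-] := ps y.
have [c ->] := gE x; exists c; rewrite linear_sum.
by apply: eq_bigr => i _; rewrite linearZ.
Qed.

Lemma fg_free n : finitely_generated (pow 'I_n B^o).
Proof.
exists n, (fun i => @single B 'I_n B^o i 1) => x; exists (coef x).
rewrite {1}(pow_ord_sum x); apply: eq_bigr => i _.
have /= <- := linearZ_LR (singlel B^o i) (coef x i) 1; congr (single i _).
by rewrite [RHS]mulr1.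
Qed.

Lemma fg_cover M : finitely_generated M ->
  exists n (p : {linear pow 'I_n B^o -> M}), surjective p.
Proof.
move=> [n [g gE]]; exists n, (pow_univ (fun i => scaleby (g i))) => x.
by have [c ->] := gE x; exists (@pow_ord n B^o c); rewrite pow_univ_ord.
Qed.

(** The supports of the images of finitely many generators bound all the others. *)
Lemma fg_supp I X M (u : {linear X -> pow I M}) : finitely_generated X ->
  exists s : seq I, forall x i, i \notin s -> coef (u x) i = 0.
Proof.
move=> [n [g gE]]; have /choice [s sE] i := pow_supp (u (g i)).
exists (flatten [seq s i | i <- enum 'I_n]) => x i ni; have [c ->] := gE x.
rewrite linear_sum coef_sum big1 // => k _.
rewrite linearZ coefZ sE ?scaler0 //.
apply: contra ni => si; apply/flattenP; exists (s k) => //.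
by apply: map_f; rewrite mem_enum.
Qed.

(** An embedding of [X] into a projective passes through finitely many coordinates of a free module.
    The new cokernel is orthogonal to projectives because maps from [X] extend to the old
    projective, hence to the finite free module. *)
Lemma fg_GP_embed X : finitely_generated X -> GP X ->
  exists n Y (j : {linear X -> pow 'I_n B^o}) (c : {linear pow 'I_n B^o -> Y}),
  [/\ ses j c, finitely_generated Y & GP Y].
Proof.
move=> fX gX; have [P [Y0 [i [p [ip Pp gY0]]]]] := GP_right gX.
have [ii _ _] := ip.
have [I [s0 [r0 rs]]] := proj_retract_free Pp.
have [s sE] := fg_supp (complin s0 i) fX.
have [n [u [v vu]]] := finite_part B^o s.
pose j := complin u (complin s0 i).
have vj x : r0 (v (j x)) = i x by rewrite /= vu ?rs //; exact: sE.
have ji : injective j.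
  by apply: lin_inj => x jx; apply: (mono0 ii); rewrite -vj jx !linear0.
have [Y [c jc]] := ses_coker ji; have [_ cs _] := jc.
exists n, Y, j, c; split=> //; first exact: fg_surj cs (fg_free n).
apply: (GP_cokernel jc gX); first exact/GP_proj/proj_free.
move=> Q Qp; apply: (orth_ses jc) => [|f].
  exact/orth_proj/proj_free.
have [g gE] := GP_orth gY0 Qp ip f.
by exists (complin g (complin r0 v)) => x; rewrite -gE -vj.
Qed.

Lemma fg_sum_split n m (M : lmodType B) (g : 'I_n -> M) (h : 'I_m -> M)
    (c : 'I_n -> B) (d : 'I_m -> B) :
  exists e : 'I_(n + m) -> B,
    \sum_i c i *: g i + \sum_i d i *: h i =
    \sum_i e i *: (match split i with inl k => g k | inr k => h k end).
Proof.
exists (fun i => match split i with inl k => c k | inr k => d k end).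
rewrite big_split_ord /=; congr (_ + _); apply: eq_bigr => i _.
  by rewrite (unsplitK (inl i)).
by rewrite (unsplitK (inr i)).
Qed.

(** The functionals embed [K] into B^n. By induction on n, the kernel of the first coordinate is
    finitely generated, and its image is a left ideal. *)
Lemma noetherian_fg n (K : lmodType B) (f : 'I_n -> {linear K -> B^o}) :
  left_noetherian B -> (forall x, (forall i, f i x = 0) -> x = 0) ->
  finitely_generated K.
Proof.
move=> noeth; elim: n K f => [|n IH] K f f0.
  exists 0, (fun=> 0) => x; exists (fun=> 0); rewrite big_ord0.
  by apply: f0 => -[].
have [L [l [li lex]]] := kernel_ex (f ord0).
have [m [h hE]] : finitely_generated L.
  apply: (IH L (fun i => complin (f (lift ord0 i)) l)) => x H.
  apply: (mono0 li); apply: f0 => i; have [k ->|->] := unliftP ord0 i.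
    exact: H.
  by apply/lex; exists x.
have [|p [a aE]] := noeth (fun b => exists x, f ord0 x = b).
  split; first by exists 0; rewrite linear0.
    by move=> _ _ [x <-] [y <-]; exists (x + y); rewrite linearD.
  by move=> b _ [x <-]; exists (b *: x); rewrite linearZ.
have /choice [y yE] i : exists x, f ord0 x = a i.
  apply/aE; exists (fun k => (k == i)%:R).
  rewrite (bigD1 i) //= eqxx mul1r big1 ?addr0 // => k /negbTE ->.
  by rewrite mul0r.
exists (p + m)%N.
exists (fun i => match split i with inl k => y k | inr k => l (h k) end).
move=> x; have [c cE] : exists c : 'I_p -> B, f ord0 x = \sum_i c i * a i.
  by apply/aE; exists x.
have [|z zE] := (lex (x - \sum_i c i *: y i)).1.
  rewrite linearB linear_sum cE; apply/eqP; rewrite subr_eq0; apply/eqP.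
  by apply: eq_bigr => i _; rewrite linearZ /= yE.
have [d dE] := hE z.
have [e eE] := fg_sum_split y (fun k => l (h k)) c d.
exists e; rewrite -eE -[LHS](subrK (\sum_i c i *: y i)) -zE dE linear_sum addrC.
by congr (_ + _); apply: eq_bigr => i _; rewrite linearZ.
Qed.

End FreeModules.

(** * Linear duals over a commutative ring *)

Section LinearDual.
Variable R : comPzRingType.
Implicit Types (X Y K G H P Q : lmodType R).

Section Module.
Variable X : lmodType R.

Definition dualm : Type := Hom X R^o.
HB.instance Definition _ := GRing.Zmodule.on dualm.

Lemma dualm_scale_linear (r : R) (f : dualm) :
  linear (fun x => r * (f x : R) : R^o).
Proof.
by move=> a x y; rewrite linearP mulrDr /=; congr (_ + _); exact: mulrCA.
Qed.
Definition dualm_scale r f : dualm := mklin (dualm_scale_linear r f).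

Lemma dualm_scaleA a b f :
  dualm_scale a (dualm_scale b f) = dualm_scale (a * b) f.
Proof. by apply: hom_ext => x; exact: mulrA. Qed.
Lemma dualm_scale1 : left_id 1 dualm_scale.
Proof. by move=> f; apply: hom_ext => x; exact: mul1r. Qed.
Lemma dualm_scaleDr : right_distributive dualm_scale +%R.
Proof. by move=> a f g; apply: hom_ext => x; exact: mulrDr. Qed.
Lemma dualm_scaleDl f : {morph dualm_scale^~ f : a b / a + b}.
Proof. by move=> a b; apply: hom_ext => x; exact: mulrDl. Qed.
HB.instance Definition _ := GRing.Zmodule_isLmodule.Build R dualm
  dualm_scaleA dualm_scale1 dualm_scaleDr dualm_scaleDl.

Lemma evl_linear x : linear (fun f : dualm => f x : R^o).
Proof. by []. Qed.
Definition evl x : {linear dualm -> R^o} := mklin (evl_linear x).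

End Module.

Lemma dualmap_linear X Y (f : {linear X -> Y}) :
  linear (fun h : dualm Y => precomp f h : dualm X).
Proof. by move=> a g h; apply: hom_ext. Qed.
Definition dualmap X Y (f : {linear X -> Y}) : {linear dualm Y -> dualm X} :=
  mklin (dualmap_linear f).

Lemma ses_dual K G H (a : {linear K -> G}) (b : {linear G -> H}) :
  ses a b -> orth H R^o -> ses (dualmap b) (dualmap a).
Proof.
move=> ab oH; have [ai bs aex] := ab; split=> [|f|f].
- apply: lin_inj => f f0; apply: hom_ext => h; have [g <-] := bs h.
  exact: (congr1 (fun k : Hom G R^o => k g) f0).
- have [g gE] := oH _ _ _ _ ab f; exists (g : dualm G).
  by apply: hom_ext => k; exact: gE.
split=> [f0|[h <-]]; last first.
  by apply: hom_ext => k; rewrite /= (ses0 k ab) linear0.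
have [|h hE] := factor_epi (h := f) bs.
  by move=> g /aex [k <-]; exact: (congr1 (fun h : Hom K R^o => h k) f0).
by exists (h : dualm H); apply: hom_ext.
Qed.

Definition basis n (i : 'I_n) : pow 'I_n R^o := @single R 'I_n R^o i 1.

Lemma single_basis n (i : 'I_n) (r : R^o) : single i r = r *: basis i.
Proof.
rewrite -(linearZ_LR (singlel R^o i)); congr (single i _).
by rewrite [RHS]mulr1.
Qed.

Lemma dual_basis n (h : dualm (pow 'I_n R^o)) :
  h = \sum_(i < n) (h (basis i) : R) *: (coefl R^o i : dualm _).
Proof.
apply: hom_ext => x; rewrite -[RHS]/(evl x _) linear_sum.
rewrite {1}(pow_ord_sum x) linear_sum; apply: eq_bigr => i _.
by rewrite single_basis linearZ; exact: mulrC.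
Qed.

Lemma proj_dual_free n : projective (dualm (pow 'I_n R^o)).
Proof.
apply: (proj_retract _ (@proj_free R 'I_n)).
exists (to_pow (F := fun i => evl (basis i)) (fun f => pow_ord_supp _)).
exists (pow_univ (fun i => scaleby (coefl R^o i : dualm _))) => f.
by rewrite pow_univ_ord [RHS]dual_basis.
Qed.

(** Embed [X] in R^n with cokernel in [GP]: every functional on [X] extends to R^n, so the
    restricted coordinates generate. *)
Lemma fg_dual X : finitely_generated X -> GP X -> finitely_generated (dualm X).
Proof.
move=> fX gX; have [n [Y [j [c [jc _ gY]]]]] := fg_GP_embed fX gX.
exists n, (fun i => dualmap j (coefl R^o i)) => f.
have [_ js _] := ses_dual jc (GP_orth gY (@proj_regular R)).
have [h <-] := js f; exists (fun i => h (basis i)).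
by rewrite {1}(dual_basis h) linear_sum; apply: eq_bigr => i _; rewrite linearZ.
Qed.

Lemma GP_separated X x : finitely_generated X -> GP X ->
  (forall f : dualm X, f x = 0) -> x = 0.
Proof.
move=> fX gX; have [n [Y [j [c [[ji _ _] _ _]]]]] := fg_GP_embed fX gX.
move=> H; apply: (mono0 ji); apply: pow_ext => i.
exact: (H (complin (coefl R^o i) j)).
Qed.

(** The values of [phi] on the restricted coordinates form a vector [v] of R^n, and [phi] is
    evaluation at [v]. Separation of [Y] by functionals then places [v] in [X]. *)
Lemma GP_reflexive X (phi : {linear dualm X -> R^o}) :
  finitely_generated X -> GP X -> exists x, forall f : dualm X, phi f = f x.
Proof.
move=> fX gX; have [n [Y [j [c [jc fY gY]]]]] := fg_GP_embed fX gX.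
have [_ js _] := ses_dual jc (GP_orth gY (@proj_regular R)).
have [_ _ jex] := jc.
pose v := @pow_ord _ n R^o (fun i => phi (dualmap j (coefl R^o i))).
have vE (h : dualm (pow 'I_n R^o)) : phi (dualmap j h) = h v.
  rewrite (dual_basis h) !linear_sum -[RHS]/(evl v _) linear_sum.
  by apply: eq_bigr => i _; rewrite !linearZ.
have [|x xv] := (jex v).1.
  (* A functional on [Y] restricts to zero on [X], so it vanishes at [c v]. *)
  apply: (GP_separated fY gY) => f.
  rewrite -[LHS]/(complin f c v) -(vE (complin f c)).
  rewrite -[RHS](linear0 phi); congr (phi _); apply: hom_ext => x /=.
  by rewrite (ses0 x jc) linear0.
by exists x => f; have [h <-] := js f; rewrite vE -xv.
Qed.

(** The duals of finitely generated modules in [GP] form a good class; dualizing exchanges left and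
    right steps. *)
Lemma GP_dual X : left_noetherian R ->
  finitely_generated X -> GP X -> GP (dualm X).
Proof.
move=> noeth fX gX.
exists (fun Z => exists X, [/\ finitely_generated X, GP X
                              & Z = dualm X :> lmodType R]).
split=> [{X fX gX} _ [X [fX gX ->]]|]; last by exists X.
have [n [Y [j [c [jc fY gY]]]]] := fg_GP_embed fX gX.
have dses := ses_dual jc (GP_orth gY (@proj_regular R)).
have [_ cs _] := jc.
split.
- move=> Q Qp; apply: (orth_ses dses) => [|f].
    exact/orth_proj/proj_dual_free.
  (* Only finitely many coordinates of [Q] matter. By reflexivity each is evaluation at an element
     of [Y]; evaluation at a preimage in R^n extends it. *)
  have [I [s [r rs]]] := proj_retract_free Qp.
  have [t tE] := fg_supp (complin s f) (fg_dual fY gY).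
  have [m [u [v vu]]] := finite_part R^o t.
  have /choice [y yE] i : exists z, forall h : dualm Y,
      coef (u (s (f h))) i = h (c z).
    have [y yE] := GP_reflexive
      (complin (coefl R^o i) (complin u (complin s f))) fY gY.
    by have [z zE] := cs y; exists z => h; rewrite zE -yE.
  exists (complin r (complin v
    (to_pow (F := fun i => evl (y i)) (fun f => pow_ord_supp _)))) => h /=.
  rewrite -[RHS]rs -(vu (s (f h))); last by move=> i; exact: tE.
  by congr (r (v _)); apply: pow_ext => i; rewrite yE.
- exists (dualm Y), (dualm (pow 'I_n R^o)), (dualmap c), (dualmap j).
  by split; [| exact: proj_dual_free | exists Y].
(* The right step dualizes a finite free cover of [X]; noetherianity makes its kernel [K] finitely
   generated, and [GP_kernel] puts it in [GP]. *)
have [m [p ps]] := fg_cover fX; have [K [k kp]] := ses_ker ps.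
have [ki _ _] := kp.
exists (dualm (pow 'I_m R^o)), (dualm K), (dualmap p), (dualmap k); split.
- exact: ses_dual kp (GP_orth gX (@proj_regular R)).
- exact: proj_dual_free.
exists K; split=> //; last first.
  by apply: GP_kernel kp _ gX; exact/GP_proj/proj_free.
apply: (noetherian_fg (f := fun i => complin (coefl R^o i) k)) => // x H.
by apply: (mono0 ki); apply: pow_ext => i; exact: H.
Qed.

End LinearDual.

(** * Restriction and coinduction *)

Section Composites.
Variable B : pzRingType.

(** The kernel of P -> G -> H is an extension of [K] by the kernel of P -> G. *)
Lemma ses_comp_left (K G H K' P : lmodType B) (a : {linear K -> G})
    (b : {linear G -> H}) (k : {linear K' -> P}) (q : {linear P -> G}) :
  ses a b -> ses k q ->
  exists (L : lmodType B) (l : {linear L -> P}) (m : {linear K' -> L})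
    (n : {linear L -> K}), ses l (complin b q) /\ ses m n.
Proof.
move=> ab kq; have [ai bs aex] := ab; have [ki qs kex] := kq.
have bqs : surjective (complin b q).
  by move=> h; have [g <-] := bs h; have [x <-] := qs g; exists x.
have [L [l lbq]] := ses_ker bqs; have [li _ lex] := lbq.
have [|m mE] := lift_mono (h := k) li.
  by move=> x; apply/lex; rewrite /= (ses0 x kq) linear0.
have [|n nE] := lift_mono (h := complin q l) ai.
  by move=> x; apply/aex; exact: (ses0 x lbq).
exists L, l, m, n; split=> //; split=> [|y|x].
- by apply: lin_inj => x x0; apply: (mono0 ki); rewrite -mE x0 linear0.
- have [x xE] := qs (a y).
  have [|z zE] := (lex x).1; first by rewrite /= xE (ses0 y ab).
  by exists z; apply: ai; rewrite nE /= zE.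
split=> [x0|[y <-]]; last by apply: (mono0 ai); rewrite nE /= mE (ses0 y kq).
have [|y yE] := (kex (l x)).1; first by rewrite -[LHS]nE x0 linear0.
by exists y; apply: li; rewrite mE.
Qed.

(** Dually, the cokernel of K -> G -> P is an extension of [Y] by [H]. *)
Lemma ses_comp_right (K G H P Y : lmodType B) (a : {linear K -> G})
    (b : {linear G -> H}) (i : {linear G -> P}) (c : {linear P -> Y}) :
  ses a b -> ses i c ->
  exists (L : lmodType B) (l : {linear P -> L}) (m : {linear H -> L})
    (n : {linear L -> Y}), ses (complin i a) l /\ ses m n.
Proof.
move=> ab ic; have [ai bs aex] := ab; have [ii cs iex] := ic.
have iai : injective (complin i a).
  by apply: lin_inj => x /(mono0 ii)/(mono0 ai).
have [L [l ial]] := ses_coker iai; have [_ ls lex] := ial.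
have [|m mE] := factor_epi (h := complin l i) bs.
  by move=> g /aex [k <-]; exact: ses0 ial.
have [|n nE] := factor_epi (h := c) ls.
  by move=> x /lex [k <-]; exact: ses0 ic.
exists L, l, m, n; split=> //; split=> [|y|x].
- apply: lin_inj => h; have [g <-] := bs h; rewrite mE /= => /lex [k /ii <-].
  exact: ses0 ab.
- by have [x <-] := cs y; exists (l x); rewrite nE.
split=> [|[h <-]]; last first.
  by have [g <-] := bs h; rewrite mE nE (ses0 g ic).
by have [z <-] := ls x; rewrite nE => /iex [g <-]; exists (b g); rewrite mE.
Qed.

End Composites.

Section Restriction.
Variables (R A : pzRingType) (phi : {rmorphism R -> A}).
Implicit Types (M N K P : lmodType A) (Q : lmodType R).

Lemma resl_linear M N (f : {linear M -> N}) :
  linear (fun x : restr phi M => f x : restr phi N).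
Proof. by move=> r x y; exact: linearP. Qed.
Definition resl M N (f : {linear M -> N}) :
  {linear restr phi M -> restr phi N} := mklin (resl_linear f).

Lemma ses_restr K M N (a : {linear K -> M}) (b : {linear M -> N}) :
  ses a b -> ses (resl a) (resl b).
Proof. by []. Qed.

Lemma retract_restr M N : retract M N -> retract (restr phi M) (restr phi N).
Proof. by move=> [s [r rs]]; exists (resl s), (resl r). Qed.

Lemma restr_pow_to_linear I M :
  linear (fun x : restr phi (pow I M) => x : pow I (restr phi M)).
Proof. by move=> r x y; apply: pow_ext. Qed.

Lemma restr_pow_from_linear I M :
  linear (fun x : pow I (restr phi M) => x : restr phi (pow I M)).
Proof. by move=> r x y; apply: (@pow_ext _ _ M). Qed.

Lemma restr_pow_retract I M :
  retract (restr phi (pow I M)) (pow I (restr phi M)).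
Proof.
by exists (mklin (@restr_pow_to_linear I M)),
          (mklin (@restr_pow_from_linear I M)).
Qed.

Section Coinduction.
Variable Q : lmodType R.

(** The coinduced module Hom_R(A, Q), right adjoint to restriction; [ev1] below is the counit and
    [adj] the transpose. *)
Definition coind : Type := Hom (restr phi A^o) Q.
HB.instance Definition _ := GRing.Zmodule.on coind.

Lemma rmulr_linear (a : A) :
  linear (fun x : restr phi A^o => (x : A) * a : restr phi A^o).
Proof.
by move=> r x y; rewrite [LHS]mulrDl; congr (_ + _); rewrite -[LHS]mulrA.
Qed.
Definition rmulr a := mklin (rmulr_linear a).

Definition coind_scale (a : A) (f : coind) : coind := precomp (rmulr a) f.

Lemma coind_scaleA a b f :
  coind_scale a (coind_scale b f) = coind_scale (a * b) f.
Proof. by apply: hom_ext => x /=; rewrite mulrA. Qed.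
Lemma coind_scale1 : left_id 1 coind_scale.
Proof. by move=> f; apply: hom_ext => x /=; rewrite mulr1. Qed.
Lemma coind_scaleDr : right_distributive coind_scale +%R.
Proof. by move=> a f g; apply: hom_ext. Qed.
Lemma coind_scaleDl f : {morph coind_scale^~ f : a b / a + b}.
Proof.
move=> a b; apply: hom_ext => x /=.
by rewrite mulrDr; exact: (raddfD (hom_fun f)).
Qed.
HB.instance Definition _ := GRing.Zmodule_isLmodule.Build A coind
  coind_scaleA coind_scale1 coind_scaleDr coind_scaleDl.

Lemma ev1_linear : linear (fun f : restr phi coind => (f : coind) (1 : A)).
Proof.
move=> r f g; congr (_ + _); rewrite -(linearZ_LR (hom_fun f)) /=.
by congr (hom_fun f _); rewrite [LHS]mul1r; symmetry; exact: mulr1.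
Qed.
Definition ev1 : {linear restr phi coind -> Q} := mklin ev1_linear.

Section Adjoint.
Variables (M : lmodType A) (f : {linear restr phi M -> Q}).

Lemma orbit_linear (m : M) :
  linear (fun a : restr phi A^o => (a : A) *: m : restr phi M).
Proof.
by move=> r a b; rewrite [LHS]scalerDl; congr (_ + _); rewrite -[LHS]scalerA.
Qed.

Definition adj_fun (m : M) : coind := complin f (mklin (orbit_linear m)).
Lemma adj_linear : linear adj_fun.
Proof.
move=> a x y; apply: hom_ext => b /=; rewrite -[RHS](linearD f); congr (f _).
by rewrite [LHS]scalerDr scalerA.
Qed.
Definition adj : {linear M -> coind} := mklin adj_linear.

Lemma adj1 m : (adj m : coind) (1 : A) = f m.
Proof. by rewrite /= scale1r. Qed.

End Adjoint.

(** Restriction is exact: transpose the map, extend it over [R], and transpose back. *)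
Lemma orth_coind M : orth (restr phi M) Q -> orth M coind.
Proof.
move=> o K E i p ip f.
have [g gE] := o _ _ _ _ (ses_restr ip) (complin ev1 (resl f)).
exists (adj g) => k; apply: hom_ext => a /=.
have -> : (a : A) *: i k = i ((a : A) *: k) by rewrite linearZ.
rewrite [LHS]gE /= linearZ /=; congr (hom_fun (f k) _).
exact: mul1r.
Qed.

(** The reverse transfer, for restrictions of exact sequences over [A]; with [orth_ses] it yields
    orthogonality of a restricted module. *)
Lemma extend_restr K P M (i : {linear K -> P}) (p : {linear P -> M})
    (f : {linear restr phi K -> Q}) : ses i p -> orth M coind ->
  exists g : {linear restr phi P -> Q}, forall k, g (i k) = f k.
Proof.
move=> ip o; have [g gE] := o _ _ _ _ ip (adj f).
by exists (complin ev1 (resl g)) => k; rewrite /= gE adj1.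
Qed.

End Coinduction.

Lemma retract_coind Q Q' : retract Q Q' -> retract (coind Q) (coind Q').
Proof.
move=> [s [r rs]].
have L (U V : lmodType R) (h : {linear U -> V}) :
    linear (fun f : coind U => complin h f : coind V).
  by move=> a f g; apply: hom_ext => x /=; exact: linearD.
by exists (mklin (L _ _ s)), (mklin (L _ _ r)) => f; apply: hom_ext => x /=.
Qed.

(** * Coinduction and direct sums *)

Section CoindPow.
Variables (I : choiceType) (Q : lmodType R).

Lemma coind_from_pow_supp (g : pow I (coind Q)) (x : restr phi A^o) :
  fsupp (fun i => coef g i x).
Proof. by have [s H] := pow_supp g; exists s => i /H ->. Qed.

Definition coind_from_pow_fun (g : pow I (coind Q)) : coind (pow I Q) :=
  to_pow (F := fun i => coef g i) (coind_from_pow_supp g).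

Lemma coind_from_pow_lin : linear coind_from_pow_fun.
Proof. by move=> a f g; apply: hom_ext => x; apply: pow_ext. Qed.

Hypothesis A_fin : finitely_generated (restr phi A^o).

(** A map out of a finite module meets finitely many coordinates, so Hom_R(A, -) commutes with
    direct sums. *)
Lemma coind_to_pow_supp (f : coind (pow I Q)) :
  fsupp (fun i => complin (coefl Q i) f : coind Q).
Proof.
have [s H] := fg_supp f A_fin; exists s => i /H f0.
by apply: hom_ext => x; exact: f0.
Qed.

Lemma coind_coef_linear i :
  linear (fun f : coind (pow I Q) => complin (coefl Q i) f : coind Q).
Proof. by move=> a f g; apply: hom_ext. Qed.

Definition coind_to_pow : {linear coind (pow I Q) -> pow I (coind Q)} :=
  to_pow (F := fun i => mklin (coind_coef_linear i)) coind_to_pow_supp.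

Lemma coind_pow_retract : retract (coind (pow I Q)) (pow I (coind Q)).
Proof.
exists coind_to_pow, (mklin coind_from_pow_lin) => f.
by apply: hom_ext => x; apply: pow_ext.
Qed.

Lemma pow_coind_retract : retract (pow I (coind Q)) (coind (pow I Q)).
Proof.
exists (mklin coind_from_pow_lin), coind_to_pow => g.
by apply: pow_ext => i; apply: hom_ext.
Qed.

End CoindPow.

(** * Ascent and descent from properties of coinduction *)

Section AscentDescent.
Hypothesis coind_proj : forall Q, projective Q -> projective (coind Q).
Hypothesis proj_coind : forall P, projective P ->
  exists2 Q : lmodType R, projective Q & retract P (coind Q).
Hypothesis A_GP : GP (restr phi A^o).

Lemma GP_restr_proj P : projective P -> GP (restr phi P).
Proof.
move=> Pp; have [I rP] := proj_retract_free Pp.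
apply: GP_retract (GP_pow I A_GP).
exact: retract_trans (retract_restr rP) (@restr_pow_retract _ _).
Qed.

(** A restricted projective is only known to be in [GP], so the good class is the extension closure
    of [GP] over [R] and the restrictions. Composing a step over [A] with one over [R] leaves an
    extension of the two kinds. *)
Lemma GP_descent M : GP M -> GP (restr phi M).
Proof.
move=> gM.
pose D (X : lmodType R) :=
  GP X \/ exists2 N, GP N & X = restr phi N :> lmodType R.
exists (extcl D); split; last by apply: extcl_base; right; exists M.
have DGP X : GP X -> extcl D X by move=> ?; apply: extcl_base; left.
have DA N : GP N -> extcl D (restr phi N).
  by move=> ?; apply: extcl_base; right; exists N.
apply: extcl_good => {M gM}X [gX|[M gM ->]].
  by split; [exact: GP_orth gX | apply: lstep_sub (GP_left gX)
            | apply: rstep_sub (GP_right gX)].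
have [oM [K [P [i [p [ip Pp gK]]]]] [P' [Y [j [c [jc Pp' gY]]]]]] := GP_good gM.
split.
- move=> Q Qp; apply: (orth_ses (ses_restr ip)) => [|f].
    exact: GP_orth (GP_restr_proj Pp) _ Qp.
  exact: extend_restr ip (oM _ (coind_proj Qp)).
- have [K2 [F [k [q [kq Fp gK2]]]]] := GP_left (GP_restr_proj Pp).
  have [L [l [m [n [lbq mn]]]]] := ses_comp_left (ses_restr ip) kq.
  exists L, F, l, (complin (resl p) q); split=> //.
  exact: extcl_ext mn (DGP _ gK2) (DA _ gK).
have [F [Y2 [k [q [kq Fp gY2]]]]] := GP_right (GP_restr_proj Pp').
have [L [l [m [n [ial mn]]]]] := ses_comp_right (ses_restr jc) kq.
exists F, L, (complin k (resl j)), l; split=> //.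
exact: extcl_ext mn (DA _ gY) (DGP _ gY2).
Qed.

(** The modules whose restriction is in [GP] form a good class. For the right step, the transpose of
    an embedding [i] into [Q] is injective by evaluation at 1. Its cokernel stays in [GP] over [R]:
    a map from [M] extends along [i] to [Q], then through [ev1] to [coind Q]. *)
Lemma GP_ascent M : GP (restr phi M) -> GP M.
Proof.
move=> gM; exists (fun N => GP (restr phi N)); split=> // {gM}M gM; split.
- move=> P Pp; have [Q Qp PQ] := proj_coind Pp.
  by apply: orth_retract_r PQ _; apply: orth_coind; exact: GP_orth gM _ Qp.
- have [I [p ps]] := free_cover M; have [K [k kp]] := ses_ker ps.
  exists K, (pow I A^o), k, p; split=> //; first exact: proj_free.
  by apply: GP_kernel (ses_restr kp) _ gM; apply/GP_restr_proj/proj_free.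
have [Q [Y [i [c [ic Qp gY]]]]] := GP_right gM; have [ii _ _] := ic.
have ai : injective (adj i).
  apply: lin_inj => m m0; apply: (mono0 ii).
  by rewrite -adj1 m0.
have [C [d ad]] := ses_coker ai.
exists (coind Q), C, (adj i), d; split=> //; first exact: coind_proj.
have gQ := GP_restr_proj (coind_proj Qp).
apply: (GP_cokernel (ses_restr ad) gM gQ) => Q' Qp'.
apply: (orth_ses (ses_restr ad)) => [|f]; first exact: GP_orth gQ _ Qp'.
have [g gE] := GP_orth gY Qp' ic f.
by exists (complin g (ev1 Q)) => m; rewrite -gE; congr (g _); exact: adj1.
Qed.

End AscentDescent.
End Restriction.

(** * The dual of the algebra *)

Section Dual.
Variables (R : comPzRingType) (A : pzRingType) (phi : {rmorphism R -> A}).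
Hypothesis phiZ : central phi.
Hypothesis A_fin : finitely_generated (restr phi A^o).

Lemma dual_coind_retract : retract (dual_left phi) (coind phi R^o).
Proof.
have L1 : linear (fun f : dual_left phi => f : coind phi R^o).
  by move=> a f g; apply: hom_ext.
have L2 : linear (fun f : coind phi R^o => f : dual_left phi).
  by move=> a f g; apply: hom_ext.
by exists (mklin L1), (mklin L2).
Qed.

Lemma coind_dual_retract : retract (coind phi R^o) (dual_left phi).
Proof.
have L1 : linear (fun f : dual_left phi => f : coind phi R^o).
  by move=> a f g; apply: hom_ext.
have L2 : linear (fun f : coind phi R^o => f : dual_left phi).
  by move=> a f g; apply: hom_ext.
by exists (mklin L2), (mklin L1).
Qed.

Lemma coind_projective (Q : lmodType R) : projective (dual_left phi) ->
  projective Q -> projective (coind phi Q).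
Proof.
move=> dp /proj_retract_free [I rQ].
apply: (proj_retract _ (proj_pow (I := I) dp)).
apply: retract_trans (retract_coind phi rQ) _.
apply: retract_trans (coind_pow_retract I _ A_fin) _.
exact/retract_pow/coind_dual_retract.
Qed.

(** A finite dual basis for the right module structure, f = \sum_l w_l theta_l(f), spelled out with
    values in [A]. *)
Definition right_dual_basis n (w : 'I_n -> dual phi)
    (theta : 'I_n -> dual phi -> A) : Prop :=
  [/\ forall l f g, theta l (f + g) = theta l f + theta l g,
      forall l a f, theta l (precomp (lmul phiZ a) f) = theta l f * a
    & forall (f : dual phi) (x : A),
        f x = \sum_(l < n) w l (theta l f * x) :> R].

Hypothesis A_GP : GP (restr phi A^o).

Lemma dual_separated (a b : A) : (forall f : dual phi, f a = f b) -> a = b.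
Proof.
move=> H; apply/eqP; rewrite -subr_eq0; apply/eqP.
apply: (GP_separated A_fin A_GP) => f.
by rewrite (linearB (hom_fun f)) H subrr.
Qed.

(** For fixed u, reflexivity makes f |-> u (theta_l f) the evaluation at an element beta_l(u) of
    [A]. The dual basis at x = 1 says that every f agrees on 1 and on the sum of the beta_l(w_l). *)
Lemma dual_generator n (w : 'I_n -> dual phi) (theta : 'I_n -> dual phi -> A) :
  right_dual_basis w theta ->
  exists beta : 'I_n -> {linear dual_left phi -> A^o},
    \sum_(l < n) beta l (w l) = 1.
Proof.
move=> [thD thM thE].
have H l (u : dual phi) :
    linear (fun f : dualm (restr phi A^o) => u (theta l f) : R^o).
  move=> r f g; rewrite thD (linearD (hom_fun u)); congr (_ + _).
  (* The scalar [r] acts as the right action of [phi r], with which [theta] commutes. *)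
  have -> : r *: f = precomp (lmul phiZ (phi r)) f.
    by apply: hom_ext => x; rewrite -[LHS](linearZ_LR (hom_fun f)).
  by rewrite thM -phiZ -[RHS](linearZ_LR (hom_fun u)).
have /choice [b bE] (lu : 'I_n * dual phi) : exists a : A, forall f : dual phi,
    lu.2 (theta lu.1 f) = f a.
  have [x xE] := GP_reflexive (mklin (H lu.1 lu.2)) A_fin A_GP.
  by exists x => f; exact: xE.
have bL l : linear (fun u : dual_left phi => b (l, u) : A^o).
  move=> a u v; apply: dual_separated => f.
  rewrite -bE (linearD (hom_fun f)) /= -(bE (l, v)).
  (* Left linearity of beta_l comes from right linearity of theta_l: moving [a] onto [f] turns u
     (theta_l f) into u (theta_l f * a). *)
  have -> : f (a * b (l, u)) = precomp (lmul phiZ a) f (b (l, u)) by [].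
  by rewrite -bE thM.
exists (fun l => mklin (bL l)); apply: dual_separated => f.
rewrite (linear_sum (hom_fun f)) thE; apply: eq_bigr => l _.
by rewrite mulr1 -bE.
Qed.

Lemma proj_retract_coind n (w : 'I_n -> dual phi)
    (theta : 'I_n -> dual phi -> A) (P : lmodType A) :
  right_dual_basis w theta -> projective P ->
  exists2 Q : lmodType R, projective Q & retract P (coind phi Q).
Proof.
move=> /dual_generator [beta betaE] /proj_retract_free [I rP].
exists (pow I (pow 'I_n R^o)); first exact/proj_pow/proj_free.
apply: retract_trans rP _.
apply: retract_trans (pow_coind_retract I _ A_fin).
apply: retract_pow.
apply: retract_trans (pow_coind_retract 'I_n _ A_fin).
suff r : retract A^o (pow 'I_n (dual_left phi)).
  exact: retract_trans r (retract_pow _ dual_coind_retract).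
pose s l := scaleby (w l : dual_left phi).
(* The map b |-> (b w_l)_l is split by the sum of the beta_l, since the beta_l(w_l) sum to 1. *)
exists (to_pow (F := s) (fun b => pow_ord_supp (fun l => s l b))).
exists (pow_univ beta) => b; rewrite pow_univ_ord -[RHS]mulr1 -betaE.
rewrite [RHS]mulr_sumr; apply: eq_bigr => l _.
exact: linearZ_LR.
Qed.

Lemma ascent_descent n (w : 'I_n -> dual phi) (theta : 'I_n -> dual phi -> A)
    (M : lmodType A) :
  right_dual_basis w theta -> projective (dual_left phi) ->
  Gorenstein_projective M <-> Gorenstein_projective (restr phi M).
Proof.
move=> wth dp; rewrite !GPP.
have cp Q := @coind_projective Q dp.
have pc P := @proj_retract_coind n w theta P wth.
by split; [exact: GP_descent | exact: GP_ascent].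
Qed.

Lemma projective_dual : left_noetherian R ->
  (forall M : lmodType A, finitely_generated M ->
     (Gorenstein_projective M <-> Gorenstein_projective (restr phi M))) ->
  projective (dual_left phi).
Proof.
move=> noeth asc.
have dfg : finitely_generated (dual_left phi).
  have [n [g gE]] := fg_dual A_fin A_GP.
  exists n, g => f; have [c cE] := gE f; exists (fun i => phi (c i)).
  rewrite [LHS]cE; apply: eq_bigr => i _; apply: hom_ext => x.
  rewrite -[LHS](linearZ_LR (hom_fun (g i))); congr (hom_fun (g i) _).
  exact: phiZ.
have dGP : GP (dual_left phi).
  apply/GPP/(asc _ dfg)/GPP.
  apply: GP_retract (GP_dual noeth A_fin A_GP).
  (* The restricted left action and the pointwise action of [R] on the dual agree because [phi] is
     central. *)
  have L1 : linear (fun f : restr phi (dual_left phi) =>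
      f : dualm (restr phi A^o)).
    move=> r f g; apply: hom_ext => x; congr (_ + _).
    rewrite -[RHS](linearZ_LR (hom_fun f)); congr (hom_fun f _).
    by symmetry; exact: phiZ.
  have L2 : linear (fun f : dualm (restr phi A^o) =>
      f : restr phi (dual_left phi)).
    move=> r f g; apply: hom_ext => x; congr (_ + _).
    rewrite -[LHS](linearZ_LR (hom_fun f)); congr (hom_fun f _).
    exact: phiZ.
  by exists (mklin L1), (mklin L2).
have [n [Y [j [c [jc fY gY]]]]] := fg_GP_embed dfg dGP.
have rY : GP (restr phi Y) by apply/GPP/(asc _ fY)/GPP.
(* Orthogonality of [Y] to the dual over [A] reduces to orthogonality to R over [R]; it splits the
   embedding [j]. *)
have oY : orth Y (dual_left phi).
  apply: orth_retract_r dual_coind_retract _; apply: orth_coind.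
  exact: GP_orth rY _ (@proj_regular R).
have [r rE] := oY _ _ _ _ jc (idlin _).
by apply: (proj_retract _ (@proj_free A 'I_n)); exists j, r.
Qed.

End Dual.

(** * Transfer to the opposite algebra *)

Section Opposite.
Variables (R : comPzRingType) (A : pzRingType) (phi : {rmorphism R -> A}).
Hypothesis phiZ : central phi.
Local Notation phi' := (op_rmor phi).

Lemma op_central : central phi'.
Proof. by move=> r a; symmetry; exact: phiZ. Qed.

Lemma op_scale (r : R) (x : A) :
  r *: (x : restr phi' A^c^o) = r *: (x : restr phi A^o) :> A.
Proof. by symmetry; exact: phiZ. Qed.

Lemma op_id_linear : linear (fun x : restr phi' A^c^o => x : restr phi A^o).
Proof. by move=> r x y; congr (_ + _); exact: op_scale. Qed.
Definition op_id := mklin op_id_linear.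

Lemma id_op_linear : linear (fun x : restr phi A^o => x : restr phi' A^c^o).
Proof. by move=> r x y; congr (_ + _); symmetry; exact: op_scale. Qed.
Definition id_op := mklin id_op_linear.

Lemma op_regular_retract : retract (restr phi' A^c^o) (restr phi A^o).
Proof. by exists op_id, id_op. Qed.

Lemma op_finite :
  finitely_generated (restr phi A^o) -> finitely_generated (restr phi' A^c^o).
Proof. by apply: (fg_surj (p := id_op)) => x; exists x. Qed.

Lemma op_dual_linear :
  linear (fun f : dual_left phi' => precomp id_op f : dual_right phiZ).
Proof. by move=> a f g; apply: hom_ext. Qed.
Lemma dual_op_linear :
  linear (fun f : dual_right phiZ => precomp op_id f : dual_left phi').
Proof. by move=> a f g; apply: hom_ext. Qed.

Lemma op_dual_retract : retract (dual_left phi') (dual_right phiZ).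
Proof.
exists (mklin op_dual_linear), (mklin dual_op_linear) => f.
by apply: hom_ext.
Qed.

Lemma dual_op_retract : retract (dual_right phiZ) (dual_left phi').
Proof.
exists (mklin dual_op_linear), (mklin op_dual_linear) => f.
by apply: hom_ext.
Qed.

Hypothesis A_fin : finitely_generated (restr phi A^o).
Hypothesis A_GP : GP (restr phi A^o).

(** Generators of the dual over [R] also generate it as a right module; a splitting of the resulting
    finite free cover supplies the coordinates [theta]. *)
Lemma right_basis : projective (dual_right phiZ) ->
  exists n (w : 'I_n -> dual phi) (theta : 'I_n -> dual phi -> A),
    right_dual_basis phiZ w theta.
Proof.
move=> dp; have [n [w wE]] := fg_dual A_fin A_GP.
pose p := pow_univ (fun l => scaleby (w l : dual_right phiZ)).
have pE (y : pow 'I_n A^c^o) (x : A) :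
    (p y : dual phi) x = \sum_(l < n) w l ((coef y l : A) * x) :> R.
  rewrite /p pow_univ_ord -[LHS]/(evl (x : restr phi A^o) _).
  by rewrite (raddf_sum (evl (x : restr phi A^o))).
have ps : surjective p.
  move=> f; have [c cE] := wE f.
  exists (@pow_ord _ n A^c^o (fun l => phi (c l))).
  apply: hom_ext => x; rewrite [LHS]pE cE -[RHS]/(evl x _) linear_sum.
  by apply: eq_bigr => l _; rewrite -[RHS](linearZ_LR (hom_fun (w l))).
have [s sE] := proj_lift (idlin _) dp ps.
exists n, w, (fun l f => coef (s f) l); split.
- by move=> l f g; rewrite linearD.
- by move=> l a f; rewrite -[precomp _ _]/((a : A^c) *: (f : dual_right phiZ))
    linearZ.
by move=> f x; rewrite -pE sE.
Qed.

Lemma left_basis : projective (dual_left phi) ->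
  exists n (w : 'I_n -> dual phi') (theta : 'I_n -> dual phi' -> A^c),
    right_dual_basis op_central w theta.
Proof.
move=> dp; have [n [w wE]] := fg_dual A_fin A_GP.
pose p := pow_univ (fun l => scaleby (w l : dual_left phi)).
have pE (y : pow 'I_n A^o) (x : A) :
    (p y : dual phi) x = \sum_(l < n) w l (x * (coef y l : A)) :> R.
  rewrite /p pow_univ_ord -[LHS]/(evl (x : restr phi A^o) _).
  by rewrite (raddf_sum (evl (x : restr phi A^o))).
have ps : surjective p.
  move=> f; have [c cE] := wE f.
  exists (@pow_ord _ n A^o (fun l => phi (c l))).
  apply: hom_ext => x; rewrite [LHS]pE cE -[RHS]/(evl x _) linear_sum.
  by apply: eq_bigr => l _; rewrite -phiZ -[RHS](linearZ_LR (hom_fun (w l))).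
have [s sE] := proj_lift (idlin _) dp ps.
(* The left structure over [A] is the right structure over the opposite algebra; [t] changes only
   the domain of the functional. *)
pose t (f : dual phi') : dual_left phi := precomp id_op f.
exists n, (fun l => precomp op_id (w l)), (fun l f => coef (s (t f)) l); split.
- move=> l f g; have -> : t (f + g) = t f + t g by apply: hom_ext.
  by rewrite linearD.
- move=> l a f; have -> : t (precomp (lmul op_central a) f) = (a : A) *: t f.
    by apply: hom_ext.
  by rewrite linearZ.
move=> f x; transitivity ((p (s (t f)) : dual phi) x : R); last exact: pE.
by rewrite sE.
Qed.

End Opposite.

Theorem theorem1p1 (R : comPzRingType) (A : pzRingType)
    (phi : {rmorphism R -> A})
    (R_noeth : left_noetherian R)
    (phiZ : central phi)
    (A_fin : finitely_generated (restr phi A^o)) :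
  (Gorenstein_projective (restr phi A^o) /\
   projective (dual_left phi) /\ projective (dual_right phiZ))
  <->
  GP_ascent_descent phi.
Proof.
have A_fin' := op_finite phiZ A_fin.
have op_GP := GP_retract (op_regular_retract phiZ).
split=> [[/GPP A_GP [dl dr]]|[asc asc']].
  split=> M _.
    have [n [w [th wth]]] := right_basis A_fin A_GP dr.
    exact: ascent_descent wth dl.
  (* Over the opposite algebra the roles swap: left projectivity gives the dual basis, right
     projectivity the projective coinduced modules. *)
  have [n [w [th wth]]] := left_basis phiZ A_fin A_GP dl.
  apply: ascent_descent wth _ => //; first exact: op_GP.
  exact: proj_retract (op_dual_retract phiZ) dr.
have A_GP : GP (restr phi A^o).
  (* The regular module is projective over [A], so descent applies to it. *)
  apply/GPP/asc; last exact/GPP/GP_proj/proj_regular.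
  exists 1%N, (fun=> 1) => x; exists (fun=> x).
  by rewrite big_ord1; symmetry; exact: mulr1.
split; first exact/GPP.
split; first exact: projective_dual.
(* Right projectivity is the left statement for [op_rmor phi]. *)
apply: proj_retract (dual_op_retract phiZ) _.
by apply: projective_dual => //; [exact: op_central | exact: op_GP].
Qed.
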